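(* Let $a\ge 2$ be an integer and let $\Psi_a=\{\psi_n\}_{n\ge 0}$ be the generalized Walsh system of order $a$ on $[0,1)$. For any $0<\varepsilon<1$ and each function $f\in L^1[0,1)$ one can find a function $g\in L^1[0,1)$ with $\operatorname{mes}\{x\in[0,1): g(x)\ne f(x)\}<\varepsilon$ such that the Fourier series $\sum_{n=0}^\infty c_n(g)\psi_n$ of $g$ with respect to $\Psi_a$, where $c_n(g)=\int_0^1 g(x)\overline{\psi_n(x)}\,dx$, converges to $g$ in the $L^1[0,1)$ norm, and the nonzero Fourier coefficients of $g$ (in the order of their indices) are monotonically decreasing in absolute value; i.e. the greedy algorithm of $g$ with respect to the system $\Psi_a$ converges in $L^1[0,1)$.
   Context: Fix an integer $a\ge 2$ and put $\omega_a=e^{2\pi i/a}$. The Rademacher system of order $a$ is defined by $\varphi_0(x)=\omega_a^k$ if $x\in\left[\frac{k}{a},\frac{k+1}{a}\right)$, $k=0,1,\dots,a-1$ (for $x\in[0,1)$), extended with period $1$, and for $n\ge 0$, $\varphi_n(x+1)=\varphi_n(x)=\varphi_0(a^n x)$. The generalized Walsh system $\Psi_a=\{\psi_n\}_{n\ge0}$ of order $a$ is defined by $\psi_0(x)=1$ and, if $n=\alpha_1a^{n_1}+\dots+\alpha_sa^{n_s}$ with $n_1>\dots>n_s\ge 0$ and $\alpha_j\in\{1,\dots,a-1\}$ (the base-$a$ expansion of $n\ge1$), $\psi_n(x)=\varphi_{n_1}^{\alpha_1}(x)\cdots\varphi_{n_s}^{\alpha_s}(x)$. Here $\operatorname{mes}$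 denotes Lebesgue measure. Greedy approximant: for $g\in L^1[0,1)$ with Fourier coefficients $c_n(g)$, the $m$-th greedy approximant with respect to $\Psi_a$ is $G_m(g)=\sum_{k\in\Lambda}c_k(g)\psi_k$, where $\Lambda\subset\{0,1,2,\dots\}$ is a set of cardinality $m$ such that $|c_n(g)|\ge|c_k(g)|$ for all $n\in\Lambda$ and $k\notin\Lambda$. The greedy algorithm of $g$ converges in $L^1[0,1)$ if the sequence $G_m(g)$ converges to $g$ in the $L^1$ norm as $m\to\infty$. *)

(* Defs.v *)
From HB Require Import structures.
From mathcomp Require Import all_boot all_order all_algebra finmap.
From mathcomp Require Import ring.
From mathcomp Require Import all_classical all_reals all_analysis.
From mathcomp Require Import complex.

Set Implicit Arguments.
Unset Strict Implicit.
Unset Printing Implicit Defensive.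

Import Order.TTheory GRing.Theory Num.Theory.
Import numFieldNormedType.Exports.

Local Open Scope classical_set_scope.
Local Open Scope ring_scope.

Section WalshSystem.
Context {R : realType}.
Implicit Types (a n : nat) (x : R).

Definition omega a : R[i] :=
  (cos (2 * pi / a%:R) +i* sin (2 * pi / a%:R))%C.

(* The k with k/a <= {x} < (k+1)/a is the integer part of a{x}, where
   {x} = x - floor x; using {x} makes phi0 1-periodic. *)
Definition phi0 a x : R[i] :=
  omega a ^+ Num.truncn (a%:R * (x - (Num.floor x)%:~R)).

Definition phi a n x : R[i] := phi0 a (a%:R ^+ n * x).

(* (n %/ a ^ j) %% a is the base-a digit of n at position j; for a >= 2 it
   vanishes for j >= n, and zero digits contribute the factor 1. *)
Definition walsh a n x : R[i] :=
  \prod_(j < n) phi a j x ^+ ((n %/ a ^ j) %% a).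

Lemma phi0E a k x : (k < a)%N -> k%:R / a%:R <= x < k.+1%:R / a%:R ->
  phi0 a x = omega a ^+ k.
Proof.
move=> ka /andP[kx xk].
have a0 : 0 < a%:R :> R by rewrite ltr0n (leq_ltn_trans _ ka).
have x0 : 0 <= x by rewrite (le_trans _ kx)// divr_ge0.
have x1 : x < 1.
  by rewrite (lt_le_trans xk)// ler_pdivrMr// mul1r ler_nat.
have fx0 : Num.floor x = 0 by apply: floor_def; rewrite x0 add0r.
rewrite /phi0 fx0 subr0; congr (_ ^+ _); apply: truncn_def.
by rewrite mulrC -ler_pdivrMr// kx -ltr_pdivlMr.
Qed.

Lemma phi_periodic a n x : phi a n (x + 1) = phi a n x.
Proof.
have -> : phi a n (x + 1) = phi0 a (a%:R ^+ n * x + (a ^ n)%:R).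
  by rewrite /phi mulrDr mulr1 natrX.
rewrite /phi /phi0 floorDrz ?rpred_nat//; congr (_ ^+ Num.truncn (_ * _)).
have -> : Num.floor ((a ^ n)%:R : R) = (a ^ n)%N%:Z.
  by rewrite -[(a ^ n)%:R]/((a ^ n)%N%:Z%:~R) intrKfloor.
by rewrite intrD -[(_%N%:Z)%:~R]/((a ^ n)%:R : R); ring.
Qed.

Lemma walsh_widen a m n x : (1 < a)%N -> (n <= m)%N ->
  walsh a n x = \prod_(j < m) phi a j x ^+ ((n %/ a ^ j) %% a).
Proof.
move=> a1 nm; rewrite /walsh.
rewrite -(big_mkord xpredT (fun j => phi a j x ^+ ((n %/ a ^ j) %% a))).
rewrite -(big_mkord xpredT (fun j => phi a j x ^+ ((n %/ a ^ j) %% a))).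
rewrite (big_cat_nat (leq0n n) nm)/= [X in _ = _ * X]big1_seq ?mulr1// => j.
rewrite mem_index_iota => /andP[_ /andP[nj _]].
by rewrite divn_small ?mod0n// (leq_ltn_trans nj)// ltn_expl.
Qed.

Lemma digit_sum a m (d : nat -> nat) j : (forall j, d j < a)%N -> (j < m)%N ->
  ((\sum_(i < m) d i * a ^ i) %/ a ^ j %% a = d j)%N.
Proof.
move=> da; elim: m d da j => // m IH d da j jm.
have a0 : (0 < a)%N by apply: leq_ltn_trans (da 0).
have -> : (\sum_(i < m.+1) d i * a ^ i =
    d 0%N + (\sum_(i < m) d i.+1 * a ^ i) * a)%N.
  rewrite big_ord_recl muln1; congr addn; rewrite big_distrl/=.
  by apply: eq_bigr => i _; rewrite expnSr mulnA.
case: j jm => [_|j jm]; first by rewrite divn1 addnC modnMDl modn_small.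
rewrite expnS divnMA divnDr ?dvdn_mull// mulnK// (divn_small (da 0)) add0n.
exact: (IH (fun j => d j.+1)).
Qed.

Lemma walsh_expansion a m (d : nat -> nat) x : (1 < a)%N ->
  (forall j, d j < a)%N ->
  walsh a (\sum_(j < m) d j * a ^ j)%N x = \prod_(j < m) phi a j x ^+ d j.
Proof.
move=> a1 da; set n := (\sum_(_ < m) _)%N.
have nam : (n < a ^ m)%N.
  rewrite /n; elim: m {n} => [|m IH]; first by rewrite big_ord0.
  rewrite big_ord_recr/= expnS (leq_trans _ (leq_mul (da m) (leqnn _)))//.
  by rewrite mulSn ltn_add2r.
rewrite (walsh_widen _ a1 (leq_maxr m n)).
rewrite -(big_mkord xpredT (fun j => phi a j x ^+ ((n %/ a ^ j) %% a))).
rewrite (big_cat_nat (leq0n m) (leq_maxl m n))/=.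
rewrite [X in _ * X = _]big1_seq ?mulr1.
  by rewrite big_mkord; apply: eq_bigr => j _; rewrite digit_sum.
move=> j; rewrite mem_index_iota => /andP[_ /andP[mj _]]; rewrite divn_small ?mod0n//.
by rewrite (leq_trans nam)// leq_pexp2l// ltnW.
Qed.

End WalshSystem.

Section L1.
Context {R : realType}.
Implicit Types f g : R -> R[i].

(* Elements of L^1[0,1) are represented by functions on R, of which only the
   values on [0,1) matter. *)
Definition inL1 f : Prop :=
  lebesgue_measure.-integrable `[0, 1[ (EFin \o (@complex.Re R \o f)) /\
  lebesgue_measure.-integrable `[0, 1[ (EFin \o (@complex.Im R \o f)).

Definition cintegral f : R[i] :=
  ((\int[lebesgue_measure]_(x in `[0, 1[) complex.Re (f x))%R +i*
   (\int[lebesgue_measure]_(x in `[0, 1[) complex.Im (f x))%R)%C.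

Definition L1norm f : \bar R :=
  (\int[lebesgue_measure]_(x in `[0%R, 1%R[) (Normc.normc (f x))%:E)%E.

Definition cvgL1 (u : nat -> R -> R[i]) g : Prop :=
  L1norm (fun x => u m x - g x) @[m --> \oo] --> 0%E.

Definition walsh_coef a g n : R[i] :=
  cintegral (fun x => g x * (walsh a n x)^*%C).

Definition walsh_partial_sum a g N x : R[i] :=
  \sum_(0 <= n < N) walsh_coef a g n * walsh a n x.

Definition greedy_set (c : nat -> R[i]) m (L : {fset nat}) : Prop :=
  #|` L| = m /\
  forall n k, n \in L -> k \notin L -> Normc.normc (c k) <= Normc.normc (c n).

Definition greedy_approximant a g (L : {fset nat}) x : R[i] :=
  \sum_(k <- L) walsh_coef a g k * walsh a k x.

(* When several coefficients have the same modulus, the m-th greedy set need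
   not be unique; convergence is required for every choice of these sets. *)
Definition greedy_algorithm_cvg a g : Prop :=
  forall L : nat -> {fset nat},
    (forall m, greedy_set (walsh_coef a g) m (L m)) ->
    cvgL1 (fun m => greedy_approximant a g (L m)) g.

Definition nonzero_decreasing (c : nat -> R[i]) : Prop :=
  forall m n, (m < n)%N -> c m != 0 -> c n != 0 ->
    Normc.normc (c n) < Normc.normc (c m).

End L1.

(* Main.v *)
Require Import Defs.
From HB Require Import structures.
From mathcomp Require Import all_boot all_order all_algebra finmap.
From mathcomp Require Import ring lra.
From mathcomp Require Import all_classical all_reals all_analysis.
From mathcomp Require Import measurable_realfun complex.

(* The building block is g 1_Delta(x) (1 - D(a^s x)), where Delta is an a-adic
   interval of rank p <= s and D is the Dirichlet kernel of order a^q, which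
   only takes the values 0 and a^q. It equals g 1_Delta outside a subset of Delta
   of measure |Delta| / a^q, its L^1 norm is at most 2 |g| |Delta|, and all its
   nonzero Walsh coefficients have the same modulus |g| / a^p and lie at indices
   in [a^s, a^(s+q)). By orthonormality the L^1 norms of its partial sums are at
   most |g| a^((q-p)/2), which is small once p is large compared with q. Cutting
   an a-adic step function into such pieces, sorted by decreasing |g| and placed
   on successive frequency ranges, gives a Walsh polynomial that agrees with it
   off a set of measure a^-q, has nonincreasing coefficients, and has partial
   sums bounded by twice the norm of the step function; damping the n-th
   coefficient by 1 - theta n makes the decrease strict.
   Starting from f, one repeatedly subtracts such a polynomial for a step
   approximation of the remainder and resets the remainder to 0 on the exceptional
   set. The remainders tend to 0 geometrically in L^1, so the polynomials sum to a
   Walsh series converging in L^1, and its sum is f off the union of the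
   exceptional sets. *)

Set Implicit Arguments.
Unset Strict Implicit.
Unset Printing Implicit Defensive.

Import Order.TTheory GRing.Theory Num.Theory.
Import numFieldNormedType.Exports.

Local Open Scope classical_set_scope.
Local Open Scope ring_scope.

(** Reindexing by division with remainder, n = k + e N; with N a power of a it separates the leading
    base-a digits of a Walsh index from the others. *)
Lemma sum_nat_mul (V : nmodType) (d N : nat) (F : nat -> V) :
  \sum_(0 <= n < d * N) F n =
  \sum_(0 <= e < d) \sum_(0 <= k < N) F (k + e * N)%N.
Proof.
elim: d => [|d IH]; first by rewrite mul0n !big_geq.
rewrite mulSn addnC (big_cat_nat (leq0n _) (leq_addr _ _))/= IH.
rewrite big_nat_recr//=; congr (_ + _).
by rewrite -{1}[(d * N)%N]add0n big_addn addKn.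
Qed.

(** * Generalized Walsh functions on a-adic intervals *)

Section Roots.
Context {R : realType}.
Implicit Types (x y : R) (z : R[i]).

Lemma cis_exprn x n :
  (cos x +i* sin x)%C ^+ n = (cos (n%:R * x) +i* sin (n%:R * x))%C :> R[i].
Proof.
elim: n => [|n IH]; first by rewrite expr0 mul0r cos0 sin0.
rewrite exprS IH -natr1 mulrDl mul1r cosD sinD.
by apply/eqP; rewrite eq_complex/=; apply/andP; split; apply/eqP; ring.
Qed.

Lemma omega_exprn a n :
  omega a ^+ n = (cos (n%:R * (2 * pi / a%:R)) +i* sin (n%:R * (2 * pi / a%:R)))%C :> R[i].
Proof. exact: cis_exprn. Qed.

Lemma omega_mulJ a : omega a * (omega a)^*%C = 1 :> R[i].
Proof.
apply/eqP; rewrite eq_complex/=; apply/andP; split; apply/eqP; last by ring.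
by rewrite mulrN opprK -!expr2 cos2Dsin2.
Qed.

Lemma omega_prim a : (0 < a)%N -> a.-primitive_root (omega a : R[i]).
Proof.
move=> a0; have a0' : (a%:R : R) != 0 by rewrite pnatr_eq0 -lt0n.
apply/andP; split => //; apply/forallP => -[i ia]/=; apply/eqP.
rewrite unity_rootE omega_exprn eq_complex/=.
have [<-|ne] := eqVneq i.+1 a.
  have -> : i.+1%:R * (2 * pi / i.+1%:R) = pi + pi :> R by field.
  by rewrite cosD sinD cospi sinpi; apply/andP; split; apply/eqP; ring.
apply/negbTE/negP => /andP[/eqP c _].
(* Half the argument of [omega a ^+ i.+1]. It lies strictly between 0 and pi, so sin y > 0, whereas
   cos (2y) = 1 would force sin y = 0. *)
pose y := i.+1%:R * pi / a%:R : R.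
have y2 : i.+1%:R * (2 * pi / a%:R) = y + y by rewrite /y; field.
have ylt : 0 < sin y.
  apply: sin_gt0_pi; rewrite /y divr_gt0 ?mulr_gt0 ?pi_gt0 ?ltr0n//=.
  by rewrite ltr_pdivrMr ?ltr0n// mulrC ltr_pM2l ?pi_gt0// ltr_nat ltn_neqAle ne.
move: c; rewrite y2 cosD -!expr2 => c.
have := cos2Dsin2 y => c2.
have : 0 < sin y ^+ 2 by rewrite exprn_gt0.
lra.
Qed.

(** Orthogonality of the characters of Z/a: the ratio is an a-th root of unity, so the geometric sum
    vanishes unless the ratio is 1. *)
Lemma sum_omega a m n : (0 < a)%N ->
  \sum_(d < a) (omega a ^+ n * (omega a ^+ m)^*%C) ^+ d =
  (if n == m %[mod a] then a%:R else 0) :> R[i].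
Proof.
move=> a0; have P := omega_prim a0.
rewrite -(eq_prim_root_expr P); set u := omega a ^+ n; set v := omega a ^+ m.
have vJ : v * v^*%C = 1 by rewrite /v rmorphXn -exprMn omega_mulJ expr1n.
have E : (u * v^*%C == 1) = (u == v).
  apply/eqP/eqP => [e|->//].
  by rewrite -[v]mul1r -e mulrAC -mulrA vJ mulr1.
rewrite -E; case: eqP => [->|/eqP ne].
  under eq_bigr do rewrite expr1n.
  by rewrite sumr_const card_ord.
have := subrX1 (u * v^*%C) a.
have -> : (u * v^*%C) ^+ a = 1.
  rewrite exprMn -rmorphXn -!exprM !(mulnC _ a) !exprM (prim_expr_order P).
  by rewrite !expr1n rmorph1 mulr1.
move/eqP; rewrite subrr eq_sym mulf_eq0 subr_eq0 (negbTE ne)/=.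
by move/eqP.
Qed.

End Roots.

Section Walsh.
Context {R : realType} (a : nat) (a1 : (1 < a)%N).
Implicit Types (x y : R) (n k p q s : nat).

Let a0 : (0 < a)%N. Proof. exact: ltnW. Qed.
Let aR0 : (0 : R) < a%:R. Proof. by rewrite ltr0n. Qed.

(** For x in [0,1), the index of the a-adic interval of rank p containing x, that is, the integer
    written with the first p base-a digits of x. *)
Definition cell p x := Num.truncn (a%:R ^+ p * x).

Lemma truncn_mulD x n m : 0 <= x -> Num.truncn (x + m%:R) = (Num.truncn x + m)%N.
Proof.
move=> x0; apply: truncn_def; rewrite natrD lerD2r -addSn natrD ltrD2r.
by apply: truncn_itv.
Qed.

Lemma truncnM_div x n : (0 < n)%N -> 0 <= x ->
  (Num.truncn (n%:R * x) %/ n)%N = Num.truncn x.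
Proof.
move=> n0 x0; have n0' : (0:R) < n%:R by rewrite ltr0n.
have nx0 : 0 <= n%:R * x by rewrite mulr_ge0// ltW.
apply/esym/truncn_def; have /andP[h1 h2] := truncn_itv nx0.
apply/andP; split.
  rewrite -(ler_pM2l n0') (le_trans _ h1)// -natrM ler_nat.
  by rewrite mulnC leq_trunc_div.
rewrite -(ltr_pM2l n0') (lt_le_trans h2)// -natrM ler_nat mulnC.
exact: ltn_ceil.
Qed.

(** Division by a^k drops the last k base-a digits. *)
Lemma cell_divn p k x : 0 <= x -> (cell (p + k) x %/ a ^ k)%N = cell p x.
Proof.
move=> x0; rewrite /cell addnC exprD -mulrA -natrX truncnM_div ?expn_gt0 ?a0//.
by rewrite mulr_ge0// exprn_ge0.
Qed.

Lemma cell_lt p x : 0 <= x < 1 -> (cell p x < a ^ p)%N.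
Proof.
move=> /andP[x0 x1]; rewrite /cell -(ltr_nat R) natrX.
have h : 0 <= a%:R ^+ p * x by rewrite mulr_ge0// exprn_ge0.
have /andP[h1 _] := truncn_itv h.
by rewrite (le_lt_trans h1)// -{2}[_ ^+ p]mulr1 ltr_pM2l// exprn_gt0.
Qed.

(** The left endpoint, used as the representative of its interval: functions constant on the
    intervals of rank p are studied through their values at these points. *)
Definition cell_point p (i : nat) : R := i%:R / (a ^ p)%:R.

Lemma cell_cell_point p i : cell p (cell_point p i) = i.
Proof. by rewrite /cell /cell_point natrX mulrCA divff ?mulr1 ?natrK// gt_eqF// exprn_gt0. Qed.

Lemma cell_point_itv p i : (i < a ^ p)%N -> 0 <= cell_point p i < 1.
Proof.
move=> h; rewrite /cell_point divr_ge0//= ltr_pdivrMr ?mul1r ?ltr_nat//.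
by rewrite ltr0n expn_gt0 a0.
Qed.

(** The exponent in [phi0] is the base-a digit of x at place j+1. The cell index of rank j+1 differs
    from it by a multiple of a, which is invisible because omega^a = 1. *)
Lemma phiE j x : 0 <= x -> phi a j x = omega a ^+ cell j.+1 x.
Proof.
move=> x0; rewrite /phi /phi0; set y := a%:R ^+ j * x.
have y0 : 0 <= y by rewrite mulr_ge0// exprn_ge0.
have fy : (Num.floor y)%:~R = (Num.truncn y)%:R :> R.
  by rewrite truncn_floor y0 -[in LHS](gez0_abs (_ : 0 <= Num.floor y)) ?floor_ge0.
have yy : 0 <= y - (Num.floor y)%:~R by rewrite subr_ge0 floor_le.
have -> : cell j.+1 x = (Num.truncn (a%:R * (y - (Num.floor y)%:~R)) + a * Num.truncn y)%N.
  rewrite -truncn_mulD ?mulr_ge0//; congr Num.truncn.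
  by rewrite fy natrM /y exprS; ring.
by rewrite exprD exprM (prim_expr_order (omega_prim a0)) expr1n mulr1.
Qed.

Lemma walsh_trunc n p x : (n < a ^ p)%N ->
  walsh a n x = \prod_(j < p) phi a j x ^+ ((n %/ a ^ j) %% a).
Proof.
move=> np; rewrite (walsh_widen _ a1 (leq_maxl n p)).
rewrite -!(big_mkord xpredT (fun j => phi a j x ^+ ((n %/ a ^ j) %% a))).
rewrite (big_cat_nat (leq0n p) (leq_maxr n p))/= [X in _ * X]big1_seq ?mulr1// => j.
rewrite mem_index_iota => /andP[_ /andP[pj _]].
by rewrite divn_small ?mod0n// (leq_trans np)// leq_exp2l.
Qed.

(** Only factors with j < p occur, and each depends on the cell of rank j+1, which the cell of rank
    p determines by division. *)
Lemma walsh_cell n p x y : (n < a ^ p)%N -> 0 <= x -> 0 <= y ->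
  cell p x = cell p y -> walsh a n x = walsh a n y.
Proof.
move=> np x0 y0 e; rewrite !(walsh_trunc _ np); apply: eq_bigr => j _.
rewrite !phiE// -(cell_divn j.+1 (p - j.+1) x0) -(cell_divn j.+1 (p - j.+1) y0).
by rewrite subnKC// e.
Qed.

Lemma walsh_cell_point n p x : (n < a ^ p)%N -> 0 <= x ->
  walsh a n x = walsh a n (cell_point p (cell p x)).
Proof.
move=> np x0; apply: (walsh_cell np) => //; first by rewrite divr_ge0.
by rewrite cell_cell_point.
Qed.

Lemma walsh0 x : walsh a 0 x = 1.
Proof. by rewrite /walsh big_ord0. Qed.

(** The digit d stands above all digits of k and so adds a single factor. This recursion drives both
    kernel computations below. *)
Lemma walshD k p d x : (k < a ^ p)%N -> (d < a)%N ->
  walsh a (k + d * a ^ p) x = walsh a k x * phi a p x ^+ d.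
Proof.
move=> kp da.
have lt : (k + d * a ^ p < a ^ p.+1)%N.
  rewrite expnS; apply: leq_trans (leq_mul da (leqnn (a ^ p))).
  by rewrite mulSn ltn_add2r.
rewrite (walsh_trunc _ lt) big_ord_recr/= (walsh_trunc _ kp).
have ap0 : (0 < a ^ p)%N by rewrite expn_gt0 a0.
congr (_ * _); last by rewrite addnC divnMDl// (divn_small kp) addn0 modn_small.
apply: eq_bigr => -[j jp] _ /=; congr (_ ^+ _).
have -> : (d * a ^ p = d * a ^ (p - j.+1) * a * a ^ j)%N.
  by rewrite -{1}(subnK jp) expnD expnS !mulnA.
by rewrite addnC divnMDl ?expn_gt0 ?a0// modnMDl.
Qed.

Lemma cell_divS p x : 0 <= x -> (cell p.+1 x %/ a)%N = cell p x.
Proof. by move=> x0; rewrite -(cell_divn p 1 x0) addn1 expn1. Qed.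

(** Induction on p: splitting off the leading digit of k multiplies the kernel of rank p by a
    character sum, which tests whether the last digits of the two cells of rank p+1 agree. *)
Lemma walsh_kernel p x y : 0 <= x < 1 -> 0 <= y < 1 ->
  \sum_(0 <= k < a ^ p) walsh a k x * (walsh a k y)^*%C =
  (if cell p x == cell p y then (a ^ p)%:R else 0) :> R[i].
Proof.
move=> x01 y01; elim: p => [|p IH].
  rewrite expn0 big_nat1 !walsh0 rmorph1 mulr1.
  have := cell_lt 0 x01; have := cell_lt 0 y01; rewrite expn0 !ltnS !leqn0.
  by move=> /eqP-> /eqP->.
have [/andP[x0 _] /andP[y0 _]] := (x01, y01).
rewrite expnS sum_nat_mul.
have : forall d, (d < a)%N ->
   \sum_(0 <= k < a ^ p) walsh a (k + d * a ^ p) x * (walsh a (k + d * a ^ p) y)^*%C =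
   (omega a ^+ cell p.+1 x * (omega a ^+ cell p.+1 y)^*%C) ^+ d *
   (if cell p x == cell p y then (a ^ p)%:R else 0) :> R[i].
  move=> d da; rewrite -IH big_distrr/=; apply: eq_big_nat => k /andP[_ kp].
  rewrite !walshD// !phiE// rmorphM/= [in LHS]rmorphXn/= exprMn; ring.
move=> E; rewrite big_mkord (eq_bigr _ (fun (i : 'I_a) _ => E i (ltn_ord i))).
rewrite -big_distrl/= sum_omega// -(cell_divS p x0) -(cell_divS p y0).
have [->|ne] := eqVneq (cell p.+1 x) (cell p.+1 y).
  by rewrite !eqxx natrM.
case: eqP => [e|_]; last by rewrite mul0r.
case: eqP => [e'|_]; last by rewrite mulr0.
by rewrite (divn_eq (cell p.+1 x) a) (divn_eq (cell p.+1 y) a) e e' eqxx in ne.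
Qed.

(* The Dirichlet kernel of order a^q, dilated by a^s. *)
Definition spike s q x : R[i] := \sum_(0 <= j < a ^ q) walsh a (j * a ^ s) x.

(** Same recursion, in q: each further digit multiplies the kernel by a character sum equal to 0 or
    a. *)
Lemma spike_val s q x : 0 <= x -> spike s q x = 0 \/ spike s q x = (a ^ q)%:R.
Proof.
move=> x0; elim: q => [|q IH]; rewrite /spike.
  by right; rewrite expn0 big_nat1 mul0n walsh0.
rewrite expnS sum_nat_mul.
(* The factor [(omega a ^+ 0)^*%C] equals 1 and gives the sum over d the shape of [sum_omega] with m
   = 0. *)
have E d : (d < a)%N -> \sum_(0 <= k < a ^ q) walsh a ((k + d * a ^ q) * a ^ s) x =
    (omega a ^+ cell (q + s).+1 x * (omega a ^+ 0)^*%C) ^+ d * spike s q x.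
  move=> da; rewrite expr0 rmorph1 mulr1 /spike big_distrr/=; apply: eq_big_nat => k /andP[_ kq].
  rewrite mulnDl -mulnA -expnD walshD//; last by rewrite expnD ltn_pmul2r// expn_gt0 a0.
  by rewrite phiE// mulrC.
rewrite big_mkord (eq_bigr _ (fun (i : 'I_a) _ => E i (ltn_ord i))).
rewrite -big_distrl sum_omega//.
case: ifP => _ /=; last by left; rewrite mul0r.
by case: IH => ->; [left; rewrite mulr0|right; rewrite natrM].
Qed.

Lemma walsh_mulJ n x : 0 <= x -> walsh a n x * (walsh a n x)^*%C = 1.
Proof.
move=> x0; rewrite /walsh rmorph_prod -big_split/=; apply: big1 => j _.
by rewrite phiE// rmorphXn rmorphXn -!exprMn omega_mulJ !expr1n.
Qed.

(** The kernel identity is orthogonality of the rows of the square matrix [W] of Walsh values, and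
    this is orthogonality of its columns: a right inverse of a square matrix is also a left
    inverse. *)
Lemma walsh_orth p n m : (n < a ^ p)%N -> (m < a ^ p)%N ->
  \sum_(0 <= i < a ^ p) walsh a n (cell_point p i) * (walsh a m (cell_point p i))^*%C =
  (if n == m then (a ^ p)%:R else 0) :> R[i].
Proof.
move=> np mp; set N := (a ^ p)%N.
have N0 : (N%:R : R[i]) != 0 by rewrite pnatr_eq0 -lt0n expn_gt0 a0.
pose W : 'M[R[i]]_N := \matrix_(i, k) walsh a k (cell_point p i).
pose V : 'M[R[i]]_N := \matrix_(k, i) ((walsh a k (cell_point p i))^*%C / N%:R).
have WV : W *m V = 1%:M.
  apply/matrixP => i j; rewrite !mxE.
  have := walsh_kernel p (cell_point_itv (ltn_ord i)) (cell_point_itv (ltn_ord j)).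
  rewrite !cell_cell_point big_mkord => E.
  under eq_bigr do rewrite !mxE mulrA.
  rewrite -big_distrl/= E -(inj_eq val_inj)/=.
  by case: eqP => _; rewrite ?mul0r// divff.
have := mulmx1C WV => /matrixP/(_ (Ordinal mp) (Ordinal np)); rewrite !mxE -(inj_eq val_inj)/=.
under eq_bigr do rewrite !mxE/= mulrAC [_ * walsh _ _ _]mulrC.
rewrite -big_distrl/= big_mkord eq_sym => /(congr1 ( *%R^~ N%:R)).
by rewrite divfK// => ->; case: eqP; rewrite ?mul0r ?mul1r.
Qed.

End Walsh.

(** * The space L^1[0,1) *)

Section NormC.
Context {R : realType}.
Implicit Types z w : R[i].
Local Notation nc := (@Normc.normc R).

Lemma normcE_sqrt z : nc z = Num.sqrt (complex.Re z ^+ 2 + complex.Im z ^+ 2).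
Proof. by case: z. Qed.

Lemma normc_ge0 z : 0 <= nc z.
Proof. by rewrite normcE_sqrt sqrtr_ge0. Qed.

Lemma sqr_normc_mulJ z : z * z^*%C = (nc z ^+ 2)%:C%C.
Proof.
case: z => x y; rewrite normcE_sqrt sqr_sqrtr ?addr_ge0 ?sqr_ge0//=.
by apply/eqP; rewrite eq_complex/=; apply/andP; split; apply/eqP; ring.
Qed.

Lemma Re_le_normc z : `|complex.Re z| <= nc z.
Proof.
by rewrite normcE_sqrt -sqrtr_sqr ler_wsqrtr// lerDl sqr_ge0.
Qed.

Lemma Im_le_normc z : `|complex.Im z| <= nc z.
Proof.
by rewrite normcE_sqrt -sqrtr_sqr ler_wsqrtr// lerDr sqr_ge0.
Qed.

Lemma normc_le_ReIm z : nc z <= `|complex.Re z| + `|complex.Im z|.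
Proof.
have h : 0 <= `|complex.Re z| + `|complex.Im z| by rewrite addr_ge0.
rewrite normcE_sqrt -(ger0_norm h) -(sqrtr_sqr (_ + _)) ler_wsqrtr//.
rewrite -(real_normK (num_real (complex.Re z))) -(real_normK (num_real (complex.Im z))).
have key (u v : R) : (u + v) ^+ 2 - (u ^+ 2 + v ^+ 2) = 2 * (u * v) by ring.
by rewrite -subr_ge0 key !mulr_ge0.
Qed.

Lemma normcJ_eq z : nc z^*%C = nc z.
Proof. by case: z => x y; rewrite !normcE_sqrt/= sqrrN. Qed.

Lemma normc_real (r : R) : nc r%:C%C = `|r|.
Proof. by rewrite normcE_sqrt/= expr0n/= addr0 sqrtr_sqr. Qed.

Lemma normc_natr n : nc n%:R = n%:R.
Proof. by rewrite -(rmorph_nat (real_complex R)) normc_real normr_nat. Qed.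

Lemma normc_sum (I : Type) (s : seq I) (P : pred I) (F : I -> R[i]) :
  nc (\sum_(i <- s | P i) F i) <= \sum_(i <- s | P i) nc (F i).
Proof.
elim/big_ind2 : _ => [|x1 x2 y1 y2 h1 h2|//]; first by rewrite Normc.normc0.
by rewrite (le_trans (le_normcD _ _))// lerD.
Qed.

Lemma normc_eq0E z : (nc z == 0) = (z == 0).
Proof.
by apply/eqP/eqP => [/Normc.eq0_normc//|->]; rewrite Normc.normc0.
Qed.

End NormC.

Section L1tools.
Context {R : realType}.
Implicit Types f g h : R -> R[i].
Local Notation mu := (@lebesgue_measure R).
Local Notation D := (`[0%R, 1%R[%classic : set R).
Local Notation nc := (@Normc.normc R).

Definition cmeas f :=
  measurable_fun D (@complex.Re R \o f) /\ measurable_fun D (@complex.Im R \o f).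

Lemma mD : measurable D. Proof. exact: measurable_itv. Qed.
Hint Resolve mD : core.

Lemma memD x : D x = (0 <= x < 1). Proof. by rewrite /= in_itv. Qed.

Lemma muD : mu D = 1%:E.
Proof. by rewrite lebesgue_measure_itv/= lte_fin ltr01 oppr0 adde0. Qed.

Lemma cmeas_cst c : cmeas (fun=> c).
Proof. by split; exact: measurable_cst. Qed.

Lemma cmeas_eq f g : (forall x, D x -> f x = g x) -> cmeas f -> cmeas g.
Proof.
move=> e [h1 h2]; split; (apply: eq_measurable_fun; last first).
- exact: h1.
- by move=> x; rewrite inE => /e /= ->.
- exact: h2.
- by move=> x; rewrite inE => /e /= ->.
Qed.

Lemma cmeasD f g : cmeas f -> cmeas g -> cmeas (fun x => f x + g x).
Proof.
move=> [f1 f2] [g1 g2]; split.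
- rewrite [X in measurable_fun _ X](_ : _ = (fun x => complex.Re (f x) + complex.Re (g x))).
    exact: measurable_funD.
  by apply/funext => x /=; case: (f x) (g x) => ? ? [].
- rewrite [X in measurable_fun _ X](_ : _ = (fun x => complex.Im (f x) + complex.Im (g x))).
    exact: measurable_funD.
  by apply/funext => x /=; case: (f x) (g x) => ? ? [].
Qed.

Lemma cmeasM f g : cmeas f -> cmeas g -> cmeas (fun x => f x * g x).
Proof.
move=> [f1 f2] [g1 g2]; split.
- rewrite [X in measurable_fun _ X](_ : _ =
    (fun x => complex.Re (f x) * complex.Re (g x) - complex.Im (f x) * complex.Im (g x))).
    by apply: measurable_funB; exact: measurable_funM.
  by apply/funext => x /=; case: (f x) (g x) => ? ? [].
- rewrite [X in measurable_fun _ X](_ : _ =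
    (fun x => complex.Re (f x) * complex.Im (g x) + complex.Im (f x) * complex.Re (g x))).
    by apply: measurable_funD; exact: measurable_funM.
  by apply/funext => x /=; case: (f x) (g x) => ? ? [].
Qed.

Lemma cmeasZ c f : cmeas f -> cmeas (fun x => c * f x).
Proof. by move=> mf; apply: cmeasM => //; exact: cmeas_cst. Qed.

Lemma cmeasB f g : cmeas f -> cmeas g -> cmeas (fun x => f x - g x).
Proof.
move=> mf mg; apply: (cmeas_eq _ (cmeasD mf (cmeasZ (-1) mg))) => x _.
by rewrite mulN1r.
Qed.

Lemma cmeasJ f : cmeas f -> cmeas (fun x => (f x)^*%C).
Proof.
move=> [f1 f2]; split.
- by rewrite [X in measurable_fun _ X](_ : _ = @complex.Re R \o f)//;
    apply/funext => x /=; case: (f x).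
- rewrite [X in measurable_fun _ X](_ : _ = (fun x => - complex.Im (f x))).
    exact: measurable_funN.
  by apply/funext => x /=; case: (f x).
Qed.

Lemma cmeas_sum (I : Type) (s : seq I) (F : I -> R -> R[i]) :
  (forall i, cmeas (F i)) -> cmeas (fun x => \sum_(i <- s) F i x).
Proof.
move=> mF; elim: s => [|i s IH].
  by apply: (cmeas_eq _ (cmeas_cst 0)) => x _; rewrite big_nil.
by apply: (cmeas_eq _ (cmeasD (mF i) IH)) => x _; rewrite big_cons.
Qed.

Lemma cmeas_normc f : cmeas f -> measurable_fun D (nc \o f).
Proof.
move=> [f1 f2].
rewrite [X in measurable_fun _ X](_ : _ =
  (@Num.sqrt R) \o (fun x => complex.Re (f x) ^+ 2 + complex.Im (f x) ^+ 2)).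
  apply: measurableT_comp.
    exact: (continuous_measurable_fun (@sqrt_continuous R)).
  by apply: measurable_funD; exact: measurable_funX.
by apply/funext => x /=; rewrite normcE_sqrt.
Qed.

Lemma cmeas_norm_EFin f : cmeas f -> measurable_fun D (fun x => (nc (f x))%:E).
Proof. by move=> /cmeas_normc ?; exact/measurable_EFinP. Qed.

Lemma L1norm_ge0 f : (0 <= L1norm f)%E.
Proof. by apply: integral_ge0 => x _; rewrite lee_fin normc_ge0. Qed.

Lemma L1norm_le f g : cmeas f -> cmeas g ->
  (forall x, D x -> nc (f x) <= nc (g x)) -> (L1norm f <= L1norm g)%E.
Proof.
move=> mf mg fg; apply: ge0_le_integral => //.
- by move=> x _; rewrite lee_fin normc_ge0.
- exact: cmeas_norm_EFin.
- exact: cmeas_norm_EFin.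
Qed.

Lemma eq_L1norm f g : (forall x, D x -> nc (f x) = nc (g x)) -> L1norm f = L1norm g.
Proof. by move=> fg; apply: eq_integral => x; rewrite inE => /fg ->. Qed.

Lemma L1norm_le_add f g h : cmeas f -> cmeas g -> cmeas h ->
  (forall x, D x -> nc (f x) <= nc (g x) + nc (h x)) ->
  (L1norm f <= L1norm g + L1norm h)%E.
Proof.
move=> mf mg mh fgh.
have [mf' mg' mh'] := And3 (cmeas_norm_EFin mf) (cmeas_norm_EFin mg) (cmeas_norm_EFin mh).
rewrite /L1norm -ge0_integralD//; [|by move=> x _; rewrite lee_fin normc_ge0..].
apply: ge0_le_integral => //.
- by move=> x _; rewrite lee_fin normc_ge0.
- exact: emeasurable_funD.
Qed.

Lemma L1normD f g : cmeas f -> cmeas g ->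
  (L1norm (fun x => f x + g x)%R <= L1norm f + L1norm g)%E.
Proof.
move=> mf mg; apply: L1norm_le_add => // [|x _]; first exact: cmeasD.
exact: le_normcD.
Qed.

Lemma L1normZ c f : cmeas f ->
  L1norm (fun x => c * f x)%R = ((nc c)%:E * L1norm f)%E.
Proof.
move=> mf; rewrite /L1norm -ge0_integralZl_EFin ?normc_ge0//.
- by apply: eq_integral => x _; rewrite Normc.normcM EFinM.
- by move=> x _; rewrite lee_fin normc_ge0.
- exact: cmeas_norm_EFin.
Qed.

(** Both directions come from |Re z|, |Im z| <= |z| <= |Re z| + |Im z|. *)
Lemma inL1P f : inL1 f <-> cmeas f /\ (L1norm f < +oo)%E.
Proof.
split=> [[/integrableP[m1 i1] /integrableP[m2 i2]]|[[m1 m2] i]].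
  have mf : cmeas f by split; exact/measurable_EFinP.
  split => //.
  apply: (@le_lt_trans _ _ (\int[mu]_(x in D) `|(complex.Re (f x))%:E| +
                            \int[mu]_(x in D) `|(complex.Im (f x))%:E|)%E).
    rewrite -ge0_integralD//; [|exact: measurableT_comp..].
    apply: ge0_le_integral => //.
    - by move=> x _; rewrite lee_fin normc_ge0.
    - exact: cmeas_norm_EFin.
    - by apply: emeasurable_funD; exact: measurableT_comp.
    - by move=> x _; rewrite -EFinD lee_fin normc_le_ReIm.
  by rewrite lte_add_pinfty.
have mn := cmeas_norm_EFin (conj m1 m2 : cmeas f).
split; apply/integrableP; split; try exact/measurable_EFinP;
  apply: le_lt_trans i; apply: ge0_le_integral => //.
- by apply: measurableT_comp => //; exact/measurable_EFinP.
- by move=> x _; rewrite lee_fin Re_le_normc.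
- by apply: measurableT_comp => //; exact/measurable_EFinP.
- by move=> x _; rewrite lee_fin Im_le_normc.
Qed.

Lemma inL1D f g : inL1 f -> inL1 g -> inL1 (fun x => f x + g x).
Proof.
move=> /inL1P[mf lf] /inL1P[mg lg]; apply/inL1P; split; first exact: cmeasD.
by rewrite (le_lt_trans (L1normD mf mg))// lte_add_pinfty.
Qed.

Lemma inL1_bounded f (M : R) : cmeas f -> (forall x, D x -> nc (f x) <= M) ->
  inL1 f /\ (L1norm f <= M%:E)%E.
Proof.
move=> mf fM.
have M0 : 0 <= M.
  by rewrite (le_trans _ (fM 0 _)) ?normc_ge0// memD lexx ltr01.
have h : (L1norm f <= M%:E)%E.
  apply: (@le_trans _ _ (L1norm (fun=> M%:C%C))).
    by apply: L1norm_le => // [|x Dx]; [exact: cmeas_cst|rewrite normc_real ger0_norm// fM].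
  by rewrite /L1norm normc_real ger0_norm// integral_cst//= muD mule1.
by split => //; apply/inL1P; split => //; rewrite (le_lt_trans h)// ltry.
Qed.

Lemma inL1_Mbounded f g (M : R) : inL1 f -> cmeas g ->
  (forall x, D x -> nc (g x) <= M) ->
  inL1 (fun x => f x * g x) /\ (L1norm (fun x => f x * g x)%R <= M%:E * L1norm f)%E.
Proof.
move=> /inL1P[mf lf] mg gM.
have M0 : 0 <= M.
  by rewrite (le_trans _ (gM 0 _)) ?normc_ge0// memD lexx ltr01.
have h : (L1norm (fun x => f x * g x)%R <= M%:E * L1norm f)%E.
  rewrite -[M in M%:E](ger0_norm M0) -normc_real -L1normZ//.
  apply: L1norm_le; [exact: cmeasM|exact: cmeasZ|move=> x Dx].
  rewrite !Normc.normcM normc_real ger0_norm// mulrC.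
  by rewrite ler_wpM2r ?normc_ge0// gM.
split => //; apply/inL1P; split; first exact: cmeasM.
rewrite (le_lt_trans h)// lte_mul_pinfty//.
Qed.

Lemma inL1Z c f : inL1 f -> inL1 (fun x => c * f x).
Proof.
move=> i; have [h _] := @inL1_Mbounded f (fun=> c) (nc c) i (cmeas_cst c) (fun _ _ => lexx _).
rewrite (_ : (fun x => c * f x) = (fun x => f x * c))//.
by apply/funext => x; rewrite mulrC.
Qed.

Lemma inL1B f g : inL1 f -> inL1 g -> inL1 (fun x => f x - g x).
Proof.
move=> lf lg; rewrite (_ : (fun _ => _) = (fun x => f x + (-1) * g x)).
  by apply: inL1D => //; exact: inL1Z.
by apply/funext => x; rewrite mulN1r.
Qed.

Lemma inL1_sum (I : Type) (s : seq I) (F : I -> R -> R[i]) :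
  (forall i, inL1 (F i)) -> inL1 (fun x => \sum_(i <- s) F i x).
Proof.
move=> mF; elim: s => [|i s IH].
  rewrite (_ : (fun _ => _) = (fun=> 0)); last by apply/funext => x; rewrite big_nil.
  by apply: (inL1_bounded (M := 0) (cmeas_cst _) _).1 => x _; rewrite Normc.normc0.
rewrite (_ : (fun _ => _) = (fun x => F i x + \sum_(j <- s) F j x)).
  exact: inL1D.
by apply/funext => x; rewrite big_cons.
Qed.

Lemma inL1_eq f g : (forall x, D x -> f x = g x) -> inL1 f -> inL1 g.
Proof.
move=> fg /inL1P[mf lf]; apply/inL1P; split; first exact: (cmeas_eq fg).
by rewrite -(@eq_L1norm f)// => x /fg ->.
Qed.

Lemma eq_cintegral f g : (forall x, D x -> f x = g x) -> cintegral f = cintegral g.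
Proof.
by move=> fg; rewrite /cintegral; congr Complex; apply: eq_Rintegral => x;
  rewrite inE => /fg ->.
Qed.

Lemma cintegralD f g : inL1 f -> inL1 g ->
  cintegral (fun x => f x + g x) = cintegral f + cintegral g.
Proof.
move=> [f1 f2] [g1 g2]; rewrite /cintegral.
rewrite [RHS](_ : _ = Complex
  (Rintegral mu D (@complex.Re R \o f) + Rintegral mu D (@complex.Re R \o g))
  (Rintegral mu D (@complex.Im R \o f) + Rintegral mu D (@complex.Im R \o g)))//.
rewrite -!RintegralD//; congr Complex; apply: eq_Rintegral => x _ /=;
  by case: (f x) (g x) => ? ? [].
Qed.

Lemma cintegralZ c f : inL1 f -> cintegral (fun x => c * f x) = c * cintegral f.
Proof.
move=> [f1 f2]; case: c => u v; rewrite /cintegral.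
have Z w (h : R -> R) : mu.-integrable D (EFin \o h) ->
    mu.-integrable D (EFin \o (fun x => w * h x)).
  by move=> ih; apply: (@integrableZl _ _ _ mu _ _ w _ ih).
apply/eqP; rewrite eq_complex/=; apply/andP; split; apply/eqP.
- rewrite -!RintegralZl// -RintegralB//; [|exact: Z..].
  by apply: eq_Rintegral => x _ /=; case: (f x).
- rewrite -!RintegralZl// -RintegralD//; [|exact: Z..].
  by apply: eq_Rintegral => x _ /=; case: (f x).
Qed.

Lemma cintegral_sum (I : Type) (s : seq I) (F : I -> R -> R[i]) :
  (forall i, inL1 (F i)) ->
  cintegral (fun x => \sum_(i <- s) F i x) = \sum_(i <- s) cintegral (F i).
Proof.
move=> mF; elim: s => [|i s IH].
  rewrite big_nil (@eq_cintegral _ (fun x => 0 * (fun=> 0) x)).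
    rewrite cintegralZ ?mul0r//.
    by apply: (inL1_bounded (M := 0) (cmeas_cst _) _).1 => x _; rewrite Normc.normc0.
  by move=> x _; rewrite big_nil mul0r.
rewrite big_cons -IH -cintegralD//; last exact: inL1_sum.
by apply: eq_cintegral => x _; rewrite big_cons.
Qed.

(** The factor 2 arises from bounding real and imaginary parts separately; it is harmless, since the
    bound is only applied to norms that tend to 0. *)
Lemma normc_cintegral_le f : inL1 f ->
  ((nc (cintegral f))%:E <= 2%:E * L1norm f)%E.
Proof.
move=> lf; have /inL1P[mf _] := lf; have [f1 f2] := lf.
apply: (@le_trans _ _ (`|complex.Re (cintegral f)| + `|complex.Im (cintegral f)|)%:E).
  by rewrite lee_fin normc_le_ReIm.
have -> : 2%:E = (1%:E + 1%:E)%E :> \bar R by rewrite -EFinD.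
rewrite ge0_muleDl ?lee_fin// mul1e EFinD.
apply: leeD.
- rewrite /= -[(`| _ |)%:E]/(`| _%:E |)%E fineK; last exact: integrable_fin_num.
  apply: (le_trans (le_abse_integral _ _ _)) => //; first exact: measurable_int f1.
  apply: ge0_le_integral => //.
  + by apply: measurableT_comp => //; exact: measurable_int f1.
  + exact: cmeas_norm_EFin.
  + by move=> x _; rewrite lee_fin Re_le_normc.
- rewrite /= -[(`| _ |)%:E]/(`| _%:E |)%E fineK; last exact: integrable_fin_num.
  apply: (le_trans (le_abse_integral _ _ _)) => //; first exact: measurable_int f2.
  apply: ge0_le_integral => //.
  + by apply: measurableT_comp => //; exact: measurable_int f2.
  + exact: cmeas_norm_EFin.
  + by move=> x _; rewrite lee_fin Im_le_normc.
Qed.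

End L1tools.

(** * Walsh polynomials *)

Section Steps.
Context {R : realType} (a : nat) (a1 : (1 < a)%N).
Implicit Types (x y t : R) (n k p q s M : nat) (c : nat -> R[i]).
Local Notation mu := (@lebesgue_measure R).
Local Notation D := (`[0%R, 1%R[%classic : set R).
Local Notation nc := (@Normc.normc R).

Let a0 : (0 < a)%N. Proof. exact: ltnW. Qed.
Let aR0 p : (0 : R) < (a ^ p)%:R. Proof. by rewrite ltr0n expn_gt0 a0. Qed.

Definition cell_set p i : set R := `[cell_point a p i, cell_point a p i.+1[%classic.

Lemma cell_setE p i x : 0 <= x -> (x \in cell_set p i) = (cell a p x == i).
Proof.
move=> x0; have h : 0 <= (a ^ p)%:R * x by rewrite mulr_ge0// ltW.
apply/idP/eqP; rewrite inE /cell_set/= in_itv/= /cell_point.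
  rewrite ler_pdivrMr// ltr_pdivlMr// => h'; apply: truncn_def.
  by rewrite -natrX mulrC.
move=> <-; rewrite ler_pdivrMr// ltr_pdivlMr// mulrC /cell -natrX.
exact: truncn_itv.
Qed.

Lemma cell_setD p i : (i < a ^ p)%N -> cell_set p i `<=` D.
Proof.
move=> ip x; rewrite /= !in_itv/= => /andP[h1 h2].
have /andP[h3 _] := @cell_point_itv R _ a1 _ _ ip.
rewrite (le_trans h3 h1)/= (lt_le_trans h2)// /cell_point ler_pdivrMr//.
by rewrite mul1r ler_nat.
Qed.

Lemma mcell_set p i : measurable (cell_set p i).
Proof. exact: measurable_itv. Qed.

Lemma mu_cell_set p i : mu (cell_set p i) = ((a ^ p)%:R^-1)%:E.
Proof.
rewrite lebesgue_measure_itv/= lte_fin /cell_point ltr_pM2r ?invr_gt0// ltr_nat ltnSn.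
by rewrite -EFinB -mulrBl -natrB// subSn// subnn mul1r.
Qed.

(** Exactly one of the indicators is nonzero at x. Measurability and integrals of step functions are
    reduced to this finite sum. *)
Lemma step_indic p (G : nat -> R) x : D x ->
  G (cell a p x) = \sum_(0 <= i < a ^ p) G i * \1_(cell_set p i) x.
Proof.
rewrite memD => x01; have /andP[x0 _] := x01.
have lt := cell_lt a1 p x01.
rewrite big_mkord (bigD1 (Ordinal lt))//= big1 ?addr0.
  by rewrite indicE cell_setE// eqxx mulr1.
move=> i ne; rewrite indicE cell_setE//.
by case: eqP => [e|_]; rewrite ?mulr0//; move: ne; rewrite -(inj_eq val_inj)/= e eqxx.
Qed.

Lemma step_meas p (G : nat -> R) : measurable_fun D (fun x => G (cell a p x)).
Proof.
apply: (@eq_measurable_fun _ _ _ _ _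
  (fun x => \sum_(0 <= i < a ^ p) G i * \1_(cell_set p i) x)).
  by move=> x; rewrite inE => /step_indic ->.
apply: measurable_sum => i; apply: measurable_funM; first exact: measurable_cst.
apply: (measurable_funS measurableT) => //.
by apply/measurable_indicP; exact: mcell_set.
Qed.

Lemma integrable_cell p i : mu.-integrable D (fun x => (\1_(cell_set p i) x)%:E).
Proof.
apply/integrableP; split.
  apply/measurable_EFinP; apply: (measurable_funS measurableT) => //.
  by apply/measurable_indicP; exact: mcell_set.
under eq_integral do rewrite gee0_abs ?lee_fin//.
rewrite integral_indic//; last exact: mcell_set.
apply: (@le_lt_trans _ _ (mu D)); last by rewrite muD ltry.
by apply: le_measure; rewrite ?inE//; apply: measurableI => //; exact: mcell_set.
Qed.

Lemma step_int p (G : nat -> R) :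
  (\int[mu]_(x in D) (G (cell a p x))%:E =
   ((a ^ p)%:R^-1 * \sum_(0 <= i < a ^ p) G i)%:E)%E.
Proof.
transitivity (\int[mu]_(x in D) (\sum_(0 <= i < a ^ p) (G i)%:E * (\1_(cell_set p i) x)%:E))%E.
  apply: eq_integral => x; rewrite inE => /step_indic ->.
  by rewrite -sumEFin; apply: eq_bigr => i _; rewrite EFinM.
rewrite integral_sum//; last first.
  by move=> i; apply: (@integrableZl _ _ _ mu) => //; exact: integrable_cell.
rewrite big_distrr/= -sumEFin; apply: eq_big_nat => i /andP[_ ip].
rewrite integralZl//; last exact: integrable_cell.
rewrite integral_indic//; last exact: mcell_set.
rewrite setIidl; last exact: cell_setD.
transitivity ((G i)%:E * ((a ^ p)%:R^-1)%:E)%E; last by rewrite -EFinM mulrC.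
by congr (_ * _)%E; exact: mu_cell_set.
Qed.

Lemma cstep_meas p (G : nat -> R[i]) : cmeas (fun x => G (cell a p x)).
Proof.
by split; [exact: (step_meas p (fun i => complex.Re (G i)))|
  exact: (step_meas p (fun i => complex.Im (G i)))].
Qed.

Lemma cstep_int p (G : nat -> R[i]) :
  cintegral (fun x => G (cell a p x)) =
  ((a ^ p)%:R^-1 * \sum_(0 <= i < a ^ p) G i).
Proof.
rewrite /cintegral /Rintegral (step_int p (fun i => complex.Re (G i))).
rewrite (step_int p (fun i => complex.Im (G i)))/=.
rewrite -(rmorph_nat (real_complex R)) -fmorphV.
have -> : \sum_(0 <= i < a ^ p) G i =
  Complex (\sum_(0 <= i < a ^ p) complex.Re (G i)) (\sum_(0 <= i < a ^ p) complex.Im (G i)).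
  elim/big_ind3 : _ => //; last by move=> i _; case: (G i).
  by move=> ? ? ? ? ? ? -> ->.
by apply/eqP; rewrite eq_complex/=; apply/andP; split; apply/eqP; ring.
Qed.

Lemma ltn_self_exp n : (n < a ^ n)%N. Proof. exact: ltn_expl. Qed.

Lemma walsh_meas n : cmeas (walsh a n : R -> R[i]).
Proof.
apply: (cmeas_eq _ (cstep_meas n (fun i => walsh a n (cell_point a n i)))).
move=> x; rewrite memD => /andP[x0 _].
by rewrite -(walsh_cell_point a1 (ltn_self_exp n) x0).
Qed.

Lemma walsh_norm n x : 0 <= x -> nc (walsh a n x) = 1.
Proof.
move=> x0; have := walsh_mulJ a1 n x0; rewrite sqr_normc_mulJ => -[] /eqP.
by rewrite sqrf_eq1 => /orP[/eqP//|/eqP e]; have := normc_ge0 (walsh a n x); rewrite e ler0N1.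
Qed.

Lemma walsh_norm_le n x : D x -> nc (walsh a n x) <= 1.
Proof. by rewrite memD => /andP[x0 _]; rewrite walsh_norm. Qed.

Lemma walsh_inL1 n : inL1 (walsh a n : R -> R[i]).
Proof. exact: (inL1_bounded (walsh_meas n) (@walsh_norm_le n)).1. Qed.

Definition walsh_sum c M x : R[i] := \sum_(0 <= n < M) c n * walsh a n x.

Local Notation wsum := walsh_sum.

Lemma wsum_inL1 c M : inL1 (wsum c M).
Proof. by apply: inL1_sum => n; apply: inL1Z; exact: walsh_inL1. Qed.

Lemma wsum_meas c M : cmeas (wsum c M).
Proof. by have /inL1P[] := wsum_inL1 c M. Qed.

(** Since n < a^n, both factors are constant on the cells of rank max(n, m), so the integral is a
    mean over grid points and discrete orthogonality applies. *)
Lemma walsh_int n m : cintegral (fun x => walsh a n x * (walsh a m x)^*%C) = (n == m)%:R :> R[i].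
Proof.
set p := maxn n m.
have np : (n < a ^ p)%N by rewrite (leq_ltn_trans (leq_maxl n m))// ltn_self_exp.
have mp : (m < a ^ p)%N by rewrite (leq_ltn_trans (leq_maxr n m))// ltn_self_exp.
pose G i : R[i] := walsh a n (cell_point a p i) * (walsh a m (cell_point a p i))^*%C.
rewrite (@eq_cintegral _ _ (fun x => G (cell a p x))).
  rewrite cstep_int walsh_orth//; case: eqP => _; rewrite ?mulr0// mulVf//.
  by rewrite pnatr_eq0 -lt0n expn_gt0 a0.
move=> x; rewrite memD => /andP[x0 _].
by rewrite (walsh_cell_point a1 np x0) (walsh_cell_point a1 mp x0).
Qed.

Lemma walsh_sum_coef c M n :
  cintegral (fun x => wsum c M x * (walsh a n x)^*%C) = (if (n < M)%N then c n else 0).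
Proof.
rewrite (@eq_cintegral _ _
  (fun x => \sum_(0 <= k < M) c k * (walsh a k x * (walsh a n x)^*%C))); last first.
  by move=> x _; rewrite /walsh_sum big_distrl/=; apply: eq_bigr => k _; rewrite mulrA.
have I k : inL1 (fun x : R => walsh a k x * (walsh a n x)^*%C).
  apply: (inL1_Mbounded (M := 1) (walsh_inL1 k) (cmeasJ (walsh_meas n)) _).1.
  by move=> x Dx; rewrite normcJ_eq walsh_norm_le.
rewrite cintegral_sum; last by move=> k; apply: inL1Z; exact: I.
under eq_bigr do rewrite cintegralZ// walsh_int.
rewrite big_mkord; case: ifPn => [nM|nM].
  rewrite (bigD1 (Ordinal nM))//= eqxx mulr1 big1 ?addr0// => k.
  by rewrite -(inj_eq val_inj)/= => /negbTE ->; rewrite mulr0.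
by rewrite big1// => k _; case: eqP => [e|_]; rewrite ?mulr0//; rewrite -e ltn_ord in nM.
Qed.

(** Parseval on the grid, computed in the complex numbers: after writing |z|^2 as z times its
    conjugate and expanding, discrete orthogonality leaves only the diagonal terms. *)
Lemma wsum_parseval c M p : (M <= a ^ p)%N ->
  \sum_(0 <= i < a ^ p) nc (wsum c M (cell_point a p i)) ^+ 2 =
  (a ^ p)%:R * \sum_(0 <= n < M) nc (c n) ^+ 2.
Proof.
move=> Mp; apply: (@complexI R).
rewrite rmorphM !rmorph_sum rmorph_nat/=.
transitivity (\sum_(0 <= i < a ^ p) \sum_(0 <= n < M) \sum_(0 <= m < M)
   c n * (c m)^*%C * (walsh a n (cell_point a p i : R) * (walsh a m (cell_point a p i))^*%C)).
  apply: eq_bigr => i _; rewrite -sqr_normc_mulJ /walsh_sum rmorph_sum/= big_distrl/=.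
  apply: eq_bigr => n _; rewrite big_distrr/=; apply: eq_bigr => m _.
  by rewrite rmorphM/=; ring.
rewrite exchange_big/= big_distrr/=; apply: eq_big_nat => n /andP[_ nM].
rewrite exchange_big/=.
transitivity (\sum_(0 <= m < M) c n * (c m)^*%C * (if n == m then (a ^ p)%:R else 0)).
  apply: eq_big_nat => m /andP[_ mM]; rewrite -big_distrr/= walsh_orth//.
  - exact: leq_trans nM Mp.
  - exact: leq_trans mM Mp.
rewrite big_mkord (bigD1 (Ordinal nM))//= eqxx big1 ?addr0.
  by rewrite -sqr_normc_mulJ mulrC.
move=> m; rewrite -(inj_eq val_inj)/= eq_sym => /negbTE ->; exact: mulr0.
Qed.

(* Cauchy-Schwarz in the form 2 |z| <= t + |z|^2 / t. *)
Lemma L1norm_wsum_le c M t : 0 < t -> \sum_(0 <= n < M) nc (c n) ^+ 2 <= t ^+ 2 ->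
  (L1norm (wsum c M) <= t%:E)%E.
Proof.
move=> t0 ht; have Mp : (M <= a ^ M)%N by rewrite ltnW// ltn_self_exp.
rewrite (@eq_L1norm _ _ (fun x => wsum c M (cell_point a M (cell a M x)))); last first.
  move=> x; rewrite memD => /andP[x0 _]; congr nc; apply: eq_big_nat => n /andP[_ nM].
  by rewrite (walsh_cell_point a1 (leq_trans nM Mp) x0).
rewrite /L1norm (step_int M (fun i => nc (wsum c M (cell_point a M i)))) lee_fin.
rewrite mulrC ler_pdivrMr//.
apply: (@le_trans _ _ (\sum_(0 <= i < a ^ M) (t + nc (wsum c M (cell_point a M i)) ^+ 2 / t) / 2)).
  apply: ler_sum => i _; set z := nc _.
  rewrite ler_pdivlMr//.
  have : 0 <= (t - z) ^+ 2 / t by rewrite divr_ge0// ?sqr_ge0 ?ltW.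
  have -> : (t - z) ^+ 2 / t = t + z ^+ 2 / t - z * 2 by field; rewrite gt_eqF.
  by rewrite subr_ge0.
rewrite -big_distrl/= big_split/= -big_distrl/= wsum_parseval// big_const_nat iter_addr_0 subn0.
rewrite ler_pdivrMr// -(mulr_natr t).
have -> : t * (a ^ M)%:R * 2 = t * (a ^ M)%:R + (a ^ M)%:R * t by ring.
by rewrite lerD2l -mulrA ler_pM2l// ler_pdivrMr// -expr2.
Qed.

End Steps.

(** * Building blocks and their concatenation *)

Section Blocks.
Context {R : realType} (a : nat) (a1 : (1 < a)%N).
Implicit Types (x y t : R) (i n k p q s M : nat) (c : nat -> R[i]) (g : R[i]).
Local Notation mu := (@lebesgue_measure R).
Local Notation D := (`[0%R, 1%R[%classic : set R).
Local Notation nc := (@Normc.normc R).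
Local Notation wsum := (walsh_sum a).

Let a0 : (0 < a)%N. Proof. exact: ltnW. Qed.
Let e0 n : (0 < a ^ n)%N. Proof. by rewrite expn_gt0 a0. Qed.
Let eR0 n : (0 : R) < (a ^ n)%:R. Proof. by rewrite ltr0n. Qed.
Let eC0 n : ((a ^ n)%:R : R[i]) != 0. Proof. by rewrite pnatr_eq0 -lt0n. Qed.

Lemma wsumD c c' M x : wsum (fun n => c n + c' n) M x = wsum c M x + wsum c' M x.
Proof. by rewrite /walsh_sum -big_split/=; apply: eq_bigr => n _; rewrite mulrDl. Qed.

Lemma wsum_eq0 c M x : (forall n, (n < M)%N -> c n = 0) -> wsum c M x = 0.
Proof.
move=> h; rewrite /walsh_sum; apply: big1_seq => n /=.
by rewrite mem_index_iota => /h ->; rewrite mul0r.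
Qed.

Lemma wsum_widen c N M x : (forall n, c n != 0 -> (n < N)%N) -> (N <= M)%N ->
  wsum c M x = wsum c N x.
Proof.
move=> h NM; rewrite /walsh_sum (big_cat_nat (leq0n _) NM)/= [X in _ + X]big1_seq ?addr0// => n.
rewrite mem_index_iota => /andP[_ /andP[Nn _]].
have [->|/h] := eqVneq (c n) 0; first by rewrite mul0r.
by rewrite ltnNge Nn.
Qed.

(** The digits of k and of j a^s occupy disjoint places. The induction runs on a bound q for the
    number of digits of j and peels off the leading one with [walshD]. *)
Lemma walsh_split s k j x : (k < a ^ s)%N ->
  walsh a (k + j * a ^ s) x = walsh a k x * walsh a (j * a ^ s) x.
Proof.
move=> ks; have : (j < a ^ j)%N by exact: ltn_expl.
move: {2}j => q; elim: q j => [|q IH] j.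
  by rewrite expn0 ltnS leqn0 => /eqP ->; rewrite mul0n addn0 walsh0 mulr1.
move=> jq.
pose j' := (j %% a ^ q)%N; pose d := (j %/ a ^ q)%N.
have -> : j = (j' + d * a ^ q)%N by rewrite addnC -divn_eq.
have j'q : (j' < a ^ q)%N by rewrite ltn_mod.
have da : (d < a)%N by rewrite ltn_divLR// -expnS.
have lt1 : (j' * a ^ s < a ^ (q + s))%N by rewrite expnD ltn_pmul2r.
have lt2 : (k + j' * a ^ s < a ^ (q + s))%N.
  rewrite expnD; apply: leq_trans (leq_mul j'q (leqnn (a ^ s))).
  by rewrite mulSn ltn_add2r.
rewrite mulnDl -mulnA -expnD addnA (walshD a1 _ lt2 da) (walshD a1 _ lt1 da) IH//.
exact/esym/mulrA.
Qed.

Section OneBlock.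
Variables (p q s i : nat) (ps : (p <= s)%N) (ip : (i < a ^ p)%N).

(* Coefficients of g 1_Delta(x) sum_(l <= j < a^q) psi_j(a^s x), Delta being
   the i-th a-adic interval of rank p. *)
Definition block l g n : R[i] :=
  if [&& l * a ^ s <= n, n < a ^ (q + s) & n %% a ^ s < a ^ p]%N
  then g / (a ^ p)%:R * (walsh a (n %% a ^ s) (cell_point a p i : R))^*%C else 0.

Lemma blockE l g j k : (k < a ^ s)%N -> (j < a ^ q)%N ->
  block l g (k + j * a ^ s) =
  if (l <= j)%N && (k < a ^ p)%N
  then g / (a ^ p)%:R * (walsh a k (cell_point a p i : R))^*%C else 0.
Proof.
move=> ks jq; rewrite /block [(k + _)%N]addnC modnMDl (modn_small ks).
have -> : (l * a ^ s <= j * a ^ s + k)%N = (l <= j)%N.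
  apply/idP/idP => h; last by rewrite (leq_trans (leq_mul h (leqnn _)))// leq_addr.
  by rewrite -ltnS -(ltn_pmul2r (e0 s)) (leq_ltn_trans h)// mulSn addnC ltn_add2r.
have -> : (j * a ^ s + k < a ^ (q + s))%N.
  rewrite expnD (leq_trans _ (leq_mul jq (leqnn (a ^ s))))// mulSn addnC ltn_add2r//.
by [].
Qed.

Let big_cells (V : nmodType) (F : nat -> V) :
  (forall k, (a ^ p <= k < a ^ s)%N -> F k = 0) ->
  \sum_(0 <= k < a ^ s) F k = \sum_(0 <= k < a ^ p) F k.
Proof.
move=> h; have ps' : (a ^ p <= a ^ s)%N by rewrite leq_exp2l.
rewrite (big_cat_nat (leq0n _) ps')/= [X in _ + X]big1_seq ?addr0// => k.
by rewrite mem_index_iota => /andP[_ /h].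
Qed.

(** Writing n = k + j a^s factorises the sum: the part over k < a^p is the kernel of rank p at the
    left endpoint of Delta, equal to a^p on Delta and 0 elsewhere. *)
Lemma wsum_block l g x : D x ->
  wsum (block l g) (a ^ (q + s)) x =
  g * (cell a p x == i)%:R * \sum_(0 <= j < a ^ q | (l <= j)%N) walsh a (j * a ^ s) x.
Proof.
rewrite memD => x01; rewrite /walsh_sum expnD sum_nat_mul big_distrr/= [RHS]big_mkcond/=.
apply: eq_big_nat => j /andP[_ jq].
under eq_big_nat => k /andP[_ ks] do rewrite blockE// walsh_split//.
case: leqP => lj /=; last by rewrite big1// => k _; rewrite mul0r.
rewrite big_cells; last first.
  by move=> k /andP[pk _]; rewrite ltnNge pk/= mul0r.
have K := walsh_kernel a1 p x01 (cell_point_itv a1 ip).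
rewrite cell_cell_point// in K.
transitivity (g / (a ^ p)%:R * walsh a (j * a ^ s) x *
   \sum_(0 <= k < a ^ p) walsh a k x * (walsh a k (cell_point a p i))^*%C).
  by rewrite big_distrr/=; apply: eq_big_nat => k /andP[_ ->]; ring.
rewrite K; case: eqP => _; last by rewrite !mulr0 mul0r.
by rewrite mulr1; field.
Qed.

Lemma block_supp l g n : block l g n != 0 -> (l * a ^ s <= n < a ^ (q + s))%N.
Proof. by rewrite /block; case: and3P => [[-> ->]//|_]; rewrite eqxx. Qed.

Lemma block_norm l g n : block l g n != 0 -> nc (block l g n) = nc g / (a ^ p)%:R.
Proof.
rewrite /block; case: and3P => [_ _|_]; last by rewrite eqxx.
rewrite !Normc.normcM Normc.normcV normc_natr normcJ_eq walsh_norm ?mulr1//.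
by have /andP[] := @cell_point_itv R _ a1 _ _ ip.
Qed.

(** There are at most a^q a^p nonzero coefficients, each of squared modulus (|g| / a^p)^2. *)
Lemma block_l2 l g M :
  \sum_(0 <= n < M) nc (block l g n) ^+ 2 <= nc g ^+ 2 * (a ^ q)%:R / (a ^ p)%:R.
Proof.
apply: (@le_trans _ _ (\sum_(0 <= n < a ^ (q + s)) nc (block l g n) ^+ 2)).
  have [le|/ltnW le] := leqP M (a ^ (q + s)).
    by rewrite [leRHS](big_cat_nat (leq0n _) le)/= lerDl sumr_ge0// => *; rewrite sqr_ge0.
  rewrite (big_cat_nat (leq0n _) le)/= [X in _ + X]big1_seq ?addr0// => n.
  rewrite mem_index_iota => /andP[_ /andP[h _]].
  have [->|/block_supp/andP[_]] := eqVneq (block l g n) 0.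
    by rewrite Normc.normc0 expr0n.
  by rewrite ltnNge h.
rewrite expnD sum_nat_mul.
apply: (@le_trans _ _ (\sum_(0 <= j < a ^ q) \sum_(0 <= k < a ^ p) (nc g / (a ^ p)%:R) ^+ 2)).
  apply: ler_sum_nat => j /andP[_ jq]; rewrite big_cells; last first.
    move=> k /andP[pk ks]; rewrite blockE// ltnNge pk andbF.
    by rewrite Normc.normc0 expr0n.
  apply: ler_sum => k _; have [->|/block_norm ->//] := eqVneq (block l g (k + j * a ^ s)) 0.
  by rewrite Normc.normc0 expr0n sqr_ge0.
rewrite !big_const_nat !iter_addr_0 !subn0.
rewrite -(mulr_natr _ (a ^ q)) -(mulr_natr _ (a ^ p)).
by rewrite le_eqVlt; apply/orP; left; apply/eqP; field; rewrite gt_eqF.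
Qed.

(** The points of Delta at which the dilated kernel does not vanish, the only ones where the block
    can differ from g 1_Delta. *)
Definition block_exc : set R :=
  [set x | D x /\ (cell a p x == i)%:R * spike a s q x != 0 :> R[i]].

Let hspk x : R[i] := (cell a p x == i)%:R * spike a s q x.

Let hspkE x : D x -> hspk x = wsum (block 0 1) (a ^ (q + s)) x.
Proof. by move=> Dx; rewrite wsum_block// mul1r. Qed.

Let hspk_inL1 : inL1 hspk.
Proof. by apply: inL1_eq (wsum_inL1 a1 (block 0 1) (a ^ (q + s))) => x /hspkE ->. Qed.

Let hspk_val x : D x -> hspk x = 0 \/ hspk x = (a ^ q)%:R.
Proof.
rewrite memD => /andP[x0 _]; rewrite /hspk.
by case: (_ == _); rewrite ?mul0r ?mul1r; [exact: spike_val|left].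
Qed.

(** The values 0 and a^q are nonnegative, so the norm is the integral, which is the coefficient of
    index 0 of the polynomial. *)
Let hspk_L1 : L1norm hspk = ((a ^ p)%:R^-1)%:E.
Proof.
have [h1 h2] := hspk_inL1.
have E : cintegral hspk = ((a ^ p)%:R^-1 : R[i]).
  transitivity (block 0 1 0).
    have := walsh_sum_coef a1 (block 0 1) (a ^ (q + s)) 0; rewrite e0 => <-.
    by apply: eq_cintegral => x Dx; rewrite hspkE// walsh0 rmorph1 mulr1.
  by rewrite /block mul0n !leq0n !e0 mod0n e0/= walsh0 rmorph1 mulr1 mul1r.
transitivity (complex.Re (cintegral hspk))%:E.
  rewrite /= fineK; last exact: integrable_fin_num.
  apply: eq_integral => x; rewrite inE => /hspk_val[] ->; first by rewrite Normc.normc0.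
  by rewrite normc_natr -(rmorph_nat (real_complex R)).
by rewrite E -(rmorph_nat (real_complex R)) -fmorphV.
Qed.

Lemma block_exc_meas : measurable block_exc.
Proof.
have /inL1P[mh _] := hspk_inL1.
rewrite (_ : block_exc = D `&` (nc \o hspk) @^-1` (~` [set 0])).
  by apply: (cmeas_normc mh) => //; apply: measurableC; exact: measurable_set1.
apply/seteqP; split => x [Dx hx]; split => //=; move: hx; rewrite /hspk /=.
  by rewrite -normc_eq0E => /eqP.
by move=> /eqP; rewrite normc_eq0E.
Qed.

(** [hspk] is a^q times the indicator of this set, so its measure is the known L^1 norm divided by
    a^q. *)
Lemma block_exc_mu : (mu block_exc = ((a ^ (p + q))%:R^-1)%:E)%E.
Proof.
have mE := block_exc_meas.
have E : L1norm hspk = (((a ^ q)%:R)%:E * mu block_exc)%E.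
  have -> : mu block_exc = (\int[mu]_(x in D) (\1_block_exc x)%:E)%E.
    by rewrite integral_indic// setIidl// => x [].
  have mI : measurable_fun D (fun x => (\1_block_exc x)%:E : \bar R).
    apply/measurable_EFinP; apply: (measurable_funS measurableT) => //.
  rewrite -ge0_integralZl_EFin//.
  apply: eq_integral => x; rewrite inE => Dx; rewrite -EFinM indicE.
  case: (boolP (x \in block_exc)); rewrite ?inE => xE.
    have [_] := xE; rewrite -/(hspk x).
    by have [->|-> _] := hspk_val Dx; rewrite ?eqxx// normc_natr mulr1.
  have [->|ne0] := eqVneq (hspk x) 0; first by rewrite Normc.normc0 mulr0.
  by exfalso; move/negP: xE; rewrite inE; apply.
have : ((((a ^ q)%:R)^-1)%:E * L1norm hspk = ((a ^ (p + q))%:R^-1)%:E)%E.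
  by rewrite hspk_L1 -EFinM expnD natrM invfM mulrC.
by rewrite E muleA -EFinM mulVf ?gt_eqF// mul1e.
Qed.

(** Taking l = 1 omits the constant term psi_0 = 1 of the Dirichlet kernel D, leaving D - 1; the
    coefficient -g then produces g (1 - D) on Delta. *)
Lemma wsum_block1 g x : D x ->
  wsum (block 1 (- g)) (a ^ (q + s)) x = g * (cell a p x == i)%:R - g * hspk x.
Proof.
move=> Dx; rewrite wsum_block// /hspk /spike.
have -> : \sum_(0 <= j < a ^ q) walsh a (j * a ^ s) x =
    1 + \sum_(0 <= j < a ^ q | (1 <= j)%N) walsh a (j * a ^ s) x.
  rewrite !big_mkord (bigD1 (Ordinal (e0 q)))//= mul0n walsh0; congr (_ + _).
  by apply: eq_bigl => j; rewrite -(inj_eq val_inj)/= lt0n.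
ring.
Qed.

Lemma wsum_block1_off g x : D x -> ~ block_exc x ->
  wsum (block 1 (- g)) (a ^ (q + s)) x = g * (cell a p x == i)%:R.
Proof.
move=> Dx nx; rewrite wsum_block1//.
have [->|ne] := eqVneq (hspk x) 0; first by rewrite mulr0 subr0.
by exfalso; apply: nx.
Qed.

Let cell_L1 : L1norm (fun x => (cell a p x == i)%:R) = ((a ^ p)%:R^-1)%:E.
Proof.
rewrite /L1norm; under eq_integral do rewrite normc_natr.
rewrite (step_int a1 p (fun j => (j == i)%:R)); congr EFin.
rewrite big_mkord (bigD1 (Ordinal ip))//= eqxx big1 ?addr0 ?mulr1//.
by move=> j; rewrite -(inj_eq val_inj)/= => /negbTE ->.
Qed.

Lemma L1norm_block1 g :
  (L1norm (wsum (block 1 (- g)%R) (a ^ (q + s))) <= (2 * (nc g / (a ^ p)%:R))%R%:E)%E.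
Proof.
have mc : cmeas (fun x : R => (cell a p x == i)%:R : R[i]).
  exact: (cstep_meas a1 p (fun j => (j == i)%:R)).
have /inL1P[mh _] := hspk_inL1.
rewrite (@eq_L1norm _ _ (fun x => g * (cell a p x == i)%:R + (- g) * hspk x)); last first.
  by move=> x Dx; rewrite wsum_block1// mulNr.
apply: (le_trans (L1normD (cmeasZ g mc) (cmeasZ (- g) mh))).
rewrite !L1normZ// cell_L1 hspk_L1 normcN -!EFinM -EFinD lee_fin.
by rewrite [2]mulr2n mulrDl mul1r.
Qed.

(** A block cut at an arbitrary M no longer has the explicit kernel form, so it is estimated through
    its L^2 norm. *)
Lemma L1norm_block_le l g M t : 0 < t -> nc g ^+ 2 * (a ^ q)%:R / (a ^ p)%:R <= t ^+ 2 ->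
  (L1norm (wsum (block l g) M) <= t%:E)%E.
Proof. by move=> t0 ht; apply: L1norm_wsum_le => //; rewrite (le_trans (block_l2 l g M)). Qed.

End OneBlock.

Definition nonincreasing_coefs c := forall m n, (m < n)%N -> c m != 0 -> c n != 0 ->
  nc (c n) <= nc (c m).

(** Induction on L: the head block lives on [a^s, a^(q+s)) and the tail starts at a^(q+s), so
    supports are disjoint and the sorting of L orders the moduli. A partial sum cuts at most one
    block: that one costs t, each completed block 2 |g| / a^p. *)
Lemma block_list (gam : nat -> R[i]) p q t (L : seq nat) s :
  0 < t -> (p <= s)%N ->
  (forall i, i \in L -> (i < a ^ p)%N) ->
  (forall i, i \in L -> nc (gam i) ^+ 2 * (a ^ q)%:R / (a ^ p)%:R <= t ^+ 2) ->
  sorted (fun i j => nc (gam j) <= nc (gam i)) L ->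
  exists c N (E : set R),
  [/\ (a ^ s <= N)%N /\ (forall n, c n != 0 -> (a ^ s <= n < N)%N),
      (forall n, c n != 0 -> exists2 i, i \in L & nc (c n) = nc (gam i) / (a ^ p)%:R),
      nonincreasing_coefs c,
      [/\ measurable E, (mu E <= ((size L)%:R / (a ^ (p + q))%:R)%R%:E)%E &
      forall x, D x -> ~ E x ->
        wsum c N x = \sum_(i <- L) gam i * (cell a p x == i)%:R] &
      forall M, (L1norm (wsum c M) <=
        (\sum_(i <- L) 2 * (nc (gam i) / (a ^ p)%:R) + t)%R%:E)%E].
Proof.
move=> t0; elim: L s => [|i L IH] s ps Lp Lt sL.
  exists (fun=> 0), (a ^ s)%N, set0; split.
  - by split => // n; rewrite eqxx.
  - by move=> n; rewrite eqxx.
  - by move=> m n _; rewrite eqxx.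
  - split=> [||x _ _]; first exact: measurable0.
      by rewrite measure0 lee_fin divr_ge0.
    by rewrite big_nil wsum_eq0.
  - move=> M; apply: (L1norm_wsum_le a1); first by rewrite big_nil add0r.
    by rewrite big1 ?sqr_ge0// => n _; rewrite Normc.normc0 expr0n.
have ip : (i < a ^ p)%N by apply: Lp; rewrite inE eqxx.
have [||||c' [N [E [[sN supp] cL cdec [mE muE offE] pL1]]]] := IH (q + s)%N.
- by rewrite (leq_trans ps)// leq_addl.
- by move=> j jL; apply: Lp; rewrite inE jL orbT.
- by move=> j jL; apply: Lt; rewrite inE jL orbT.
- exact: path_sorted sL.
pose b := block p q s i 1 (- gam i).
have bs n : b n != 0 -> (a ^ s <= n < a ^ (q + s))%N.
  by move=> /block_supp; rewrite mul1n.
have bn n : b n != 0 -> nc (b n) = nc (gam i) / (a ^ p)%:R.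
  by move=> /(block_norm ip); rewrite normcN.
have b0 n : (a ^ (q + s) <= n)%N -> b n = 0.
  by move=> h; apply/eqP/negP => /negP/bs; rewrite [X in _ && X]ltnNge h andbF.
have c0 n : (n < a ^ (q + s))%N -> c' n = 0.
  by move=> h; apply/eqP/negP => /negP/supp; rewrite leqNgt h.
have tr : transitive (fun i j => nc (gam j) <= nc (gam i)).
  by move=> ? ? ? h1 h2; exact: le_trans h2 h1.
have Lhd j : j \in L -> nc (gam j) <= nc (gam i).
  by have /allP := order_path_min tr (sL : path _ i L); apply.
have cases n : b n + c' n != 0 ->
    [/\ (n < a ^ (q + s))%N, b n != 0 & b n + c' n = b n] \/
    [/\ (a ^ (q + s) <= n)%N, c' n != 0 & b n + c' n = c' n].
  have [h|h] := ltnP n (a ^ (q + s)); first by rewrite (c0 n h) addr0; left.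
  by rewrite (b0 n h) add0r; right.
have ss : (a ^ s <= a ^ (q + s))%N by rewrite leq_exp2l// leq_addl.
exists (fun n => b n + c' n), N, (block_exc p q s i `|` E); split.
- split; first exact: leq_trans sN.
  move=> n /cases[[h /bs/andP[h1 h2] _]|[h /supp/andP[h1 h2] _]].
    by rewrite h1/= (leq_trans h2).
  by rewrite h2 (leq_trans ss).
- move=> n /cases[[_ /bn h ->]|[_ /cL[j jL h] ->]].
    by exists i => //; rewrite inE eqxx.
  by exists j => //; rewrite inE jL orbT.
- move=> m n mn /cases[[m1 m2 ->]|[m1 m2 ->]] /cases[[n1 n2 ->]|[n1 n2 ->]].
  + by rewrite !bn.
  + have [j jL ->] := cL _ n2.
    by rewrite bn// ler_wpM2r ?invr_ge0// Lhd.
  + by have := ltn_trans mn n1; rewrite ltnNge m1.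
  + exact: cdec.
- have mB := block_exc_meas q ps ip.
  split; first exact: measurableU.
    apply: (le_trans (measureU2 _ _ _)) => //.
    rewrite [in (_ <= _)%E]/= -[in leRHS]natr1 mulrDl EFinD addeC leeD//.
    by rewrite mul1r (block_exc_mu q ps ip).
  move=> x Dx nE; rewrite wsumD big_cons; congr (_ + _).
    rewrite (wsum_widen _ _ sN); last by move=> n /bs/andP[].
    by apply: wsum_block1_off => // h; apply: nE; left.
  by apply: offE => // h; apply: nE; right.
- move=> M; rewrite big_cons.
  have sum0 : 0 <= \sum_(j <- L) 2 * (nc (gam j) / (a ^ p)%:R).
    by apply: sumr_ge0 => j _; rewrite mulr_ge0// divr_ge0// normc_ge0.
  (* Either the cut falls in the head block and the tail has not started, or the head is complete
     and the cut concerns the tail. *)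
  have [le|/ltnW le] := leqP M (a ^ (q + s)).
    rewrite (@eq_L1norm _ _ (wsum b M)); last first.
      move=> x _; rewrite wsumD [X in _ + X]wsum_eq0 ?addr0// => n nM.
      by apply: c0; exact: leq_trans nM le.
    apply: (@le_trans _ _ t%:E).
      apply: L1norm_block_le => //; rewrite normcN; apply: Lt.
      by rewrite inE eqxx.
    by rewrite lee_fin lerDr addr_ge0// mulr_ge0// divr_ge0// normc_ge0.
  rewrite (@eq_L1norm _ _ (fun x => wsum b (a ^ (q + s)) x + wsum c' M x)); last first.
    move=> x _; rewrite wsumD (wsum_widen _ _ le)// => n /bs/andP[]//.
  apply: (le_trans (L1normD (wsum_meas a1 _ _) (wsum_meas a1 _ _))).
  rewrite -[X in X%:E]addrA EFinD; apply: leeD; last exact: pL1.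
  exact: (L1norm_block1 q ps ip).
Qed.

End Blocks.

(** * Approximation off a small set *)

Section Stage.
Context {R : realType} (a : nat) (a1 : (1 < a)%N).
Implicit Types (x y t : R) (i n k p q s M : nat) (c : nat -> R[i]) (g : R[i]).
Local Notation mu := (@lebesgue_measure R).
Local Notation D := (`[0%R, 1%R[%classic : set R).
Local Notation nc := (@Normc.normc R).
Local Notation wsum := (walsh_sum a).

Let a0 : (0 < a)%N. Proof. exact: ltnW. Qed.
Let e0 n : (0 < a ^ n)%N. Proof. by rewrite expn_gt0 a0. Qed.
Let eR0 n : (0 : R) < (a ^ n)%:R. Proof. by rewrite ltr0n. Qed.

Lemma div_exp_small (X y : R) : 0 < y ->
  exists p0, forall p, (p0 <= p)%N -> X / (a ^ p)%:R < y.
Proof.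
move=> y0; exists (Num.truncn (X / y)).+1 => p hp.
rewrite ltr_pdivrMr// mulrC -ltr_pdivrMr//.
apply: (lt_le_trans (truncnS_gt (X / y))).
by rewrite ler_nat (leq_trans hp)// ltnW// ltn_expl.
Qed.

Lemma L1norm_wsum_abs c M :
  (L1norm (wsum c M) <= (\sum_(0 <= n < M) nc (c n))%:E)%E.
Proof.
apply: (inL1_bounded (wsum_meas a1 c M) _).2 => x Dx.
apply: (le_trans (normc_sum _ _ _)); apply: ler_sum => n _.
by rewrite Normc.normcM ler_piMr ?normc_ge0// (walsh_norm_le a1).
Qed.

Lemma strictly_decreasing_coefs c N (eta : R) : 0 < eta -> (forall n, c n != 0 -> (n < N)%N) ->
  nonincreasing_coefs c ->
  exists c', [/\ forall n, c' n != 0 -> c n != 0, forall n, nc (c' n) <= nc (c n),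
    nonzero_decreasing c' &
    forall M, (L1norm (fun x => wsum c' M x - wsum c M x)%R <= eta%:E)%E].
Proof.
move=> eta0 supp dec; pose S := \sum_(0 <= n < N) nc (c n).
have S0 : 0 <= S by apply: sumr_ge0 => n _; exact: normc_ge0.
(* Chosen so that theta n < 1 and theta n S <= eta for all n <= N: the damping factors stay positive
   and the coefficients change by at most eta in total. *)
pose th := Num.min 1 eta / (N.+1%:R * (1 + S)).
have d0 : 0 < N.+1%:R * (1 + S) by rewrite mulr_gt0// ltr_pwDl.
have m0 : 0 < Num.min 1 eta by rewrite lt_min ltr01.
have th0 : 0 < th by rewrite divr_gt0.
have thN n : (n <= N)%N -> th * n%:R < 1 /\ th * n%:R * S <= eta.
  move=> nN; have nN' : n%:R <= N.+1%:R :> R by rewrite ler_nat ltnW.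
  have ht : th * (N.+1%:R * (1 + S)) = Num.min 1 eta by rewrite /th divfK// gt_eqF.
  have h1 : Num.min 1 eta <= 1 by rewrite ge_min lexx.
  have h2 : Num.min 1 eta <= eta by rewrite ge_min lexx orbT.
  split.
    apply: (@lt_le_trans _ _ (th * (N.+1%:R * (1 + S)))); last by rewrite ht.
    rewrite ltr_pM2l//; apply: (@lt_le_trans _ _ N.+1%:R).
      by rewrite ltr_nat.
    by rewrite ler_peMr// lerDl.
  apply: (@le_trans _ _ (th * (N.+1%:R * (1 + S)))); last by rewrite ht.
  by rewrite -mulrA ler_pM2l// ler_pM// lerDr.
pose c' n := ((1 - th * n%:R)%:C)%C * c n.
have c'n n : c n != 0 -> nc (c' n) = (1 - th * n%:R) * nc (c n).
  move=> /supp/ltnW/thN[h _]; rewrite /c' Normc.normcM normc_real ger0_norm// subr_ge0.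
  exact: ltW.
have cc n : c' n != 0 -> c n != 0.
  by apply: contra_neq => cn; rewrite /c' cn mulr0.
exists c'; split => //.
- move=> n; have [cn|cn] := eqVneq (c n) 0.
    by rewrite /c' cn mulr0 Normc.normc0.
  by rewrite c'n// ler_piMl ?normc_ge0// gerDl oppr_le0 mulr_ge0// ltW.
- move=> m n mn /cc cm /cc cn; rewrite !c'n//.
  have [h1 _] := thN _ (ltnW (supp _ cn)).
  have cm0 : 0 < nc (c m) by rewrite lt_neqAle eq_sym normc_eq0E cm normc_ge0.
  apply: (@le_lt_trans _ _ ((1 - th * n%:R) * nc (c m))).
    by rewrite ler_wpM2l ?dec// subr_ge0 ltW.
  by rewrite ltr_pM2r// ltrD2l ltrN2 ltr_pM2l// ltr_nat.
(* The change of the coefficients. As |psi_n| = 1, the sum of its moduli bounds the L^1 norm of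
   every partial sum. *)
- move=> M; pose d n : R[i] := - ((th * n%:R)%:C)%C * c n.
  have ds n : d n != 0 -> (n < N)%N.
    by move=> dn; apply: supp; move: dn; apply: contra_neq => cn; rewrite /d cn mulr0.
  rewrite (@eq_L1norm _ _ (wsum d M)); last first.
    move=> x _; congr nc; rewrite /walsh_sum -sumrB; apply: eq_bigr => n _.
    by rewrite /c' /d rmorphB rmorph1; ring.
  apply: (le_trans (L1norm_wsum_abs d M)); rewrite lee_fin.
  have dl n : nc (d n) = th * n%:R * nc (c n).
    rewrite /d Normc.normcM normcN normc_real ger0_norm// mulr_ge0//.
    exact: ltW.
  apply: (@le_trans _ _ (\sum_(0 <= n < N) nc (d n))).
    have [le|/ltnW le] := leqP M N.
      by rewrite [leRHS](big_cat_nat (leq0n _) le)/= lerDl sumr_ge0// => *; exact: normc_ge0.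
    rewrite (big_cat_nat (leq0n _) le)/= [X in _ + X]big1_seq ?addr0// => n.
    rewrite mem_index_iota => /andP[_ /andP[h _]].
    have [->|/ds] := eqVneq (d n) 0; first by rewrite Normc.normc0.
    by rewrite ltnNge h.
  apply: (@le_trans _ _ (th * N%:R * S)); last by have [] := thN N (leqnn N).
  rewrite big_distrr/=; apply: ler_sum_nat => n /andP[_ nN]; rewrite dl.
  apply: ler_wpM2r; first exact: normc_ge0.
  by apply: ler_wpM2l; [exact: ltW|rewrite ler_nat ltnW].
Qed.

Lemma ecvg0_lt (u : nat -> \bar R) (e : R) : u n @[n --> \oo] --> 0%E -> 0 < e ->
  exists N, forall n, (N <= n)%N -> (u n < e%:E)%E.
Proof.
move=> /(fine_cvgP _ _).1[fu /cvgrPdist_lt/(_ e) h] e0'.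
have [N _ hN] := filterI fu (h e0'); exists N => n /hN[/= fn].
rewrite sub0r normrN => lt; rewrite -(fineK fn) lte_fin.
exact: le_lt_trans (ler_norm _) lt.
Qed.

Lemma ecvg0_le (u : nat -> \bar R) : (forall n, 0 <= u n)%E ->
  (forall e : R, 0 < e -> exists N, forall n, (N <= n)%N -> (u n <= e%:E)%E) ->
  u n @[n --> \oo] --> 0%E.
Proof.
move=> u0 h.
have fin n e : (u n <= e%:E)%E -> u n \is a fin_num.
  by move=> le; rewrite ge0_fin_numE// (le_lt_trans le)// ltry.
apply/(fine_cvgP _ _); split.
  by have [N hN] := h 1 ltr01; exists N => // n /hN/fin.
apply/cvgrPdist_lt => e e0'; have [|N hN] := h (e / 2); first by rewrite divr_gt0.
exists N => // n /hN /= le; rewrite sub0r normrN ger0_norm ?fine_ge0//.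
apply: (@le_lt_trans _ _ (e / 2)); last by rewrite ltr_pdivrMr// ltr_pMr// ltr1n.
by rewrite -lee_fin fineK// (fin _ _ le).
Qed.

Lemma cell_point_cell_bounds p x : 0 <= x ->
  cell_point a p (cell a p x) <= x < cell_point a p (cell a p x) + (a ^ p)%:R^-1.
Proof.
move=> x0; have : x \in cell_set a p (cell a p x) by rewrite cell_setE.
rewrite inE /cell_set /= in_itv/= => /andP[-> h]; rewrite (lt_le_trans h)//.
by rewrite /cell_point -natr1 mulrDl mul1r.
Qed.

Lemma cell_point_cell_cvg x : 0 <= x -> cell_point a p (cell a p x) @[p --> \oo] --> x.
Proof.
move=> x0; apply/cvgrPdist_lt => e e0'; have [N hN] := div_exp_small 1 e0'.
exists N => // p /hN; rewrite /= div1r => h.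
have /andP[h1 h2] := cell_point_cell_bounds p x0.
by rewrite ger0_norm ?subr_ge0// ltrBlDl (lt_le_trans h2)// lerD2l ltW.
Qed.

Lemma cmeas_if (E : set R) (f g : R -> R[i]) : measurable E -> cmeas f -> cmeas g ->
  cmeas (fun x => if x \in E then f x else g x).
Proof.
move=> mE mf mg.
have mI : cmeas (fun x => ((\1_E x : R)%:C)%C : R[i]).
  split; last exact: measurable_cst.
  apply: (measurable_funS measurableT) => //; exact/measurable_indicP.
apply: (cmeas_eq _ (cmeasD (cmeasM mI mf) (cmeasM (cmeasB (cmeas_cst 1) mI) mg))) => x _.
by rewrite indicE; case: (x \in E); rewrite /= ?subrr ?subr0 ?mul1r ?mul0r ?addr0 ?add0r.
Qed.

(** Continuous functions are dense in L^1, and sampling a continuous g at left endpoints converges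
    to g by dominated convergence. The statement covers all large p because p must later satisfy
    further conditions. *)
Lemma step_approx_real (h : R -> R) (eta : R) : 0 < eta ->
  mu.-integrable D (EFin \o h) ->
  exists g : R -> R, exists B : R, exists p0 : nat,
    (forall x, D x -> `|g x| <= B) /\
    forall p, (p0 <= p)%N ->
      (\int[mu]_(x in D) (`|h x - g (cell_point a p (cell a p x))|)%:E <= eta%:E)%E.
Proof.
move=> eta0 ih.
have e2 : 0 < eta / 2 by rewrite divr_gt0.
have Doo : (mu D < +oo)%E by rewrite [X in (X < _)%E](@muD R) ltry.
have [gs [cg ig cvg]] := approximation_continuous_integrable (measurable_itv _) Doo ih.
have [N hN] := ecvg0_lt cvg e2.
have {hN} := hN N (leqnn N); move: (cg N) (ig N); move: (gs N) => g {cg ig cvg gs} cg ig hg.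
have cn : {within `[0, 1], continuous (fun x => `|g x|)}.
  apply: continuous_subspaceT => x.
  by apply: continuous_comp; [exact: cg|exact: norm_continuous].
have [c _ hc] := EVT_max ler01 cn.
(* The maximum of |g| over the closed interval [0,1]; the constant B is the dominating function. *)
pose B := `|g c|; have gB x : D x -> `|g x| <= B.
  by rewrite memD => /andP[x0 x1]; apply: hc; rewrite in_itv/= x0 ltW.
exists g, B.
have xcpt p x : D x -> D (cell_point a p (cell a p x)).
  by rewrite !memD => x01; apply: cell_point_itv => //; exact: cell_lt.
have mg : measurable_fun D g.
  apply: (measurable_funS measurableT) => //; exact: continuous_measurable_fun.
have [||||||_ +  _] := @dominated_convergence _ _ R mu D _
   (fun p x => (g (cell_point a p (cell a p x)))%:E) (EFin \o g) (fun=> B%:E).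
- exact: measurable_itv.
- by move=> p; apply/measurable_EFinP; exact: (step_meas a1 p (fun i => g (cell_point a p i))).
- exact/measurable_EFinP.
- apply: aeW => x; rewrite memD => /andP[x0 _]; apply: cvg_EFin; first by near=> n.
  by apply: (cvg_comp _ _ (cell_point_cell_cvg x0)); exact: cg.
- by have [[iB _] _] := inL1_bounded (cmeas_cst ((B%:C)%C : R[i])) (fun x _ => lexx _).
- by apply: aeW => x n Dx; rewrite lee_fin gB//; exact: xcpt.
move=> cv; have [p0 hp0] := ecvg0_lt cv e2; exists p0; split => // p /hp0 {}hp0.
have -> : eta%:E = ((eta / 2)%:E + (eta / 2)%:E)%E.
  by rewrite -EFinD -mulr2n -(mulr_natr (eta / 2)) divfK.
have mp : measurable_fun D (fun x => g (cell_point a p (cell a p x))).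
  exact: (step_meas a1 p (fun i => g (cell_point a p i))).
have mh : measurable_fun D h by apply/measurable_EFinP; exact: measurable_int ih.
have hg' := leeD (ltW hg) (ltW hp0); apply: le_trans hg'.
rewrite /= -ge0_integralD//; last 2 first.
- by apply/measurable_EFinP/measurableT_comp => //; exact: measurable_funB.
- by apply/measurable_EFinP/measurableT_comp => //; exact: measurable_funB.
apply: ge0_le_integral => //.
- by apply/measurable_EFinP/measurableT_comp => //; exact: measurable_funB.
- by apply: emeasurable_funD; apply/measurable_EFinP/measurableT_comp => //; exact: measurable_funB.
move=> x _; rewrite -EFinD lee_fin; apply: (le_trans (ler_distD (g x) _ _)).
by rewrite lerD2l distrC.
Unshelve. all: by end_near. Qed.

(** The bound B is independent of p; hence the block coefficients, of modulus at most B / a^p,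
    become small as the cells are refined. *)
Lemma step_approx (f : R -> R[i]) (eta : R) : 0 < eta -> inL1 f ->
  exists G : R -> R[i], exists B : R, exists p0 : nat,
    (forall x, D x -> nc (G x) <= B) /\
    forall p, (p0 <= p)%N ->
      (L1norm (fun x => f x - G (cell_point a p (cell a p x)))%R <= eta%:E)%E.
Proof.
move=> eta0 [i1 i2]; have e2 : 0 < eta / 2 by rewrite divr_gt0.
have [g1 [B1 [p1 [hB1 hp1]]]] := step_approx_real e2 i1.
have [g2 [B2 [p2 [hB2 hp2]]]] := step_approx_real e2 i2.
exists (fun x => Complex (g1 x) (g2 x)), (B1 + B2), (maxn p1 p2); split.
  by move=> x Dx; rewrite (le_trans (normc_le_ReIm _))// lerD ?hB1 ?hB2.
move=> p; rewrite geq_max => /andP[/hp1 {}hp1 /hp2 {}hp2].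
have -> : eta%:E = ((eta / 2)%:E + (eta / 2)%:E)%E.
  by rewrite -EFinD -mulr2n -(mulr_natr (eta / 2)) divfK.
apply: le_trans (leeD hp1 hp2).
have m1 : measurable_fun D (@complex.Re R \o f) by apply/measurable_EFinP; exact: measurable_int i1.
have m2 : measurable_fun D (@complex.Im R \o f) by apply/measurable_EFinP; exact: measurable_int i2.
have mp1 := step_meas a1 p (fun i => g1 (cell_point a p i)).
have mp2 := step_meas a1 p (fun i => g2 (cell_point a p i)).
have M1 : measurable_fun D (fun x => (`|(@complex.Re R \o f) x - g1 (cell_point a p (cell a p x))|)%:E).
  by apply/measurable_EFinP/measurableT_comp => //; exact: measurable_funB.
have M2 : measurable_fun D (fun x => (`|(@complex.Im R \o f) x - g2 (cell_point a p (cell a p x))|)%:E).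
  by apply/measurable_EFinP/measurableT_comp => //; exact: measurable_funB.
rewrite -ge0_integralD//.
apply: ge0_le_integral => //.
- by move=> x _; rewrite lee_fin normc_ge0.
- apply: cmeas_norm_EFin; apply: cmeasB; first by split.
  by split; [exact: mp1|exact: mp2].
- exact: emeasurable_funD.
- move=> x _; rewrite -EFinD lee_fin (le_trans (normc_le_ReIm _))//=.
  by case: (f x) => u v /=.
Qed.

Lemma approx_off_small_set (f : R -> R[i]) N0 (kap del eta : R) :
  inL1 f -> 0 < kap -> 0 < del -> 0 < eta ->
  exists c N (E : set R),
  [/\ (N0 < N)%N /\ (forall n, c n != 0 -> (N0 <= n < N)%N),
      forall n, nc (c n) < kap,
      nonzero_decreasing c,
      [/\ measurable E, (mu E <= del%:E)%E &
      (L1norm (fun x => if x \in E then 0 else f x - wsum c N x)%R <= eta%:E)%E] &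
      forall M, (L1norm (wsum c M) <= 2%:E * L1norm f + eta%:E)%E].
Proof.
(* The budget of four t: the step function exceeds [f] in norm by at most t, which the blocks
   double, the cut block costs t, and the damping costs t. *)
move=> lf kap0 del0 eta0; pose t := eta / 4.
have t0 : 0 < t by rewrite divr_gt0.
have [G [B0 [p0 [hB hp0]]]] := step_approx t0 lf.
pose B := `|B0| + 1; have B1 : 0 < B by rewrite ltr_wpDl.
have {}hB x : D x -> nc (G x) <= B.
  by move=> /hB h; rewrite (le_trans h)// (le_trans (ler_norm _))// lerDl.
(* q is fixed before p: the a^p exceptional sets, each of measure a^-(p+q), have total measure at
   most a^-q whatever p is. *)
have [q0 /(_ q0 (leqnn _)) hq] := div_exp_small 1 del0.
have [p1 hp1] := div_exp_small B kap0.
have [p2 hp2] := div_exp_small (B ^+ 2 * (a ^ q0)%:R) (exprn_gt0 2 t0).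
(* Beyond three thresholds: [p0] for the step approximation, [p1] for coefficients below [kap], [p2]
   for the norm of a cut block. *)
pose p := (p0 + p1 + p2)%N.
have {}hp0 := hp0 p (leq_trans (leq_addr p1 p0) (leq_addr p2 _)).
have {}hp1 := hp1 p (leq_trans (leq_addl p0 p1) (leq_addr p2 _)).
have {}hp2 := hp2 p (leq_addl _ _).
pose gam i := G (cell_point a p i).
have gB i : (i < a ^ p)%N -> nc (gam i) <= B.
  by move=> ip; apply: hB; rewrite memD; exact: cell_point_itv.
pose r := (fun i j => nc (gam j) <= nc (gam i)) : rel nat.
pose L := sort r (iota 0 (a ^ p)).
have Lmem i : i \in L -> (i < a ^ p)%N by rewrite mem_sort mem_iota add0n.
have rt : total r by move=> i j; rewrite /r orbC; exact: le_total.
(* The starting rank s = p + N0 meets both demands, p <= s and a^s > N0. *)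
have [|c [N [E [[sN supp] cL cdec [mE muE offE] pL1]]]] := @block_list R a a1
  gam p q0 t L (p + N0) t0 (leq_addr N0 p) Lmem _ (sort_sorted rt (iota 0 (a ^ p))).
  move=> i iL; apply: le_trans (ltW hp2); rewrite ler_wpM2r ?invr_ge0//.
  rewrite ler_wpM2r// lerXn2r// ?nnegrE ?normc_ge0// ?(ltW B1)//.
  exact: gB (Lmem _ iL).
have sumL (V : nmodType) (F : nat -> V) :
    \sum_(i <- L) F i = \sum_(0 <= i < a ^ p) F i.
  rewrite (perm_big (iota 0 (a ^ p))) ?perm_sort//.
  by rewrite /index_iota subn0.
have offE' x : D x -> ~ E x -> wsum c N x = gam (cell a p x).
  move=> Dx nE; rewrite offE// sumL.
  have lt : (cell a p x < a ^ p)%N by apply: cell_lt => //; rewrite -memD.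
  rewrite big_mkord (bigD1 (Ordinal lt))//= eqxx mulr1 big1 ?addr0// => i.
  by rewrite -(inj_eq val_inj)/= eq_sym => /negbTE ->; rewrite mulr0.
have /inL1P[mf _] := lf.
have mS : cmeas (fun x => gam (cell a p x)) := cstep_meas a1 p gam.
pose v := (a ^ p)%:R^-1 * \sum_(0 <= i < a ^ p) nc (gam i).
have vE : L1norm (fun x => gam (cell a p x)) = v%:E.
  by rewrite /L1norm (step_int a1 p (fun i => nc (gam i))).
have vle : (v%:E <= L1norm f + t%:E)%E.
  rewrite -vE (@eq_L1norm _ _ (fun x => f x + (-1) * (f x - gam (cell a p x)))).
    apply: (le_trans (L1normD mf (cmeasZ (-1) (cmeasB mf mS)))).
    rewrite L1normZ; last exact: cmeasB.
    by rewrite normcN Normc.normc1 mul1e leeD2l.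
  by move=> x _; congr nc; ring.
have supp' n : c n != 0 -> (n < N)%N by move=> /supp/andP[].
have [c' [cc c'le c'dec c'L1]] := strictly_decreasing_coefs t0 supp' cdec.
have N0le : (N0 < a ^ (p + N0))%N.
  by apply: (leq_trans (ltn_expl N0 a1)); rewrite leq_exp2l// leq_addl.
exists c', N, E; split.
- split; first exact: leq_trans sN.
  by move=> n /cc/supp/andP[h ->]; rewrite (leq_trans (ltnW N0le) h).
- move=> n; apply: (le_lt_trans (c'le n)).
  have [->|/cL[i iL ->]] := eqVneq (c n) 0; first by rewrite Normc.normc0.
  by apply: le_lt_trans hp1; rewrite ler_wpM2r ?invr_ge0// gB// Lmem.
- exact: c'dec.
- split=> //.
    apply: (le_trans muE); rewrite lee_fin size_sort size_iota expnD natrM.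
    rewrite invfM mulrA divff ?gt_eqF// (le_trans _ (ltW hq))//.
  have mc := wsum_meas a1 c N; have mc' := wsum_meas a1 c' N.
  have tt : (t%:E + t%:E <= eta%:E)%E.
    by rewrite -EFinD lee_fin /t -mulr2n -mulr_natr; lra.
  apply: le_trans tt; apply: le_trans (leeD hp0 (c'L1 N)).
  have m1 := cmeasB mf mS; have m2 := cmeasB mc' mc.
  apply: L1norm_le_add => //.
    apply: cmeas_if => //; first exact: cmeas_cst.
    exact: cmeasB.
  move=> x Dx.
  case: ifPn => [_|]; first by rewrite Normc.normc0 addr_ge0// normc_ge0.
  rewrite notin_setE => nE; rewrite -[X in _ <= _ + X]normcN.
  apply: le_trans (le_normcD _ _).
  rewrite le_eqVlt; apply/orP; left; apply/eqP; congr nc.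
  by rewrite (offE' x Dx nE) /gam; ring.
- move=> M.
  have -> : wsum c' M = (fun x => wsum c M x + (wsum c' M x - wsum c M x)).
    by apply/funext => x; ring.
  have mc := wsum_meas a1 c M; have mc' := wsum_meas a1 c' M.
  apply: (le_trans (L1normD mc (cmeasB mc' mc))).
  apply: (le_trans (leeD (pL1 M) (c'L1 M))).
  have -> : \sum_(i <- L) 2 * (nc (gam i) / (a ^ p)%:R) = 2 * v.
    rewrite sumL /v big_distrr/= big_distrr/=; apply: eq_bigr => i _.
    by rewrite [_^-1 * _]mulrC.
  have [u uE] : exists u : R, L1norm f = u%:E.
    exists (fine (L1norm f)); rewrite fineK// ge0_fin_numE ?L1norm_ge0//.
    by have /inL1P[] := lf.
  rewrite uE -EFinD lee_fin in vle.
  rewrite uE -EFinD -[leRHS]/((2 * u + eta)%R%:E) lee_fin.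
  have -> : eta = 4 * t by rewrite /t mulrC divfK.
  lra.
Qed.
End Stage.

(** * Convergence of series in L^1 and of the greedy algorithm *)

Section Greedy.
Context {R : realType} (a : nat).
Local Notation nc := (@Normc.normc R).

(** Up to indices with zero coefficient, a greedy set is an initial segment of the nonzero
    coefficients, so each greedy approximant is a partial sum; its order N can be taken large once m
    is. *)
Lemma greedy_cvg_decreasing (g : R -> R[i]) : cvgL1 (walsh_partial_sum a g) g ->
  nonzero_decreasing (walsh_coef a g) -> greedy_algorithm_cvg a g.
Proof.
set c := walsh_coef a g => cv dec L HL.
apply: ecvg0_le => [n|e e0]; first exact: L1norm_ge0.
have [N0 hN0] := ecvg0_lt cv e0; exists N0.+1 => m N0m.
have [Lm gr] := HL m.
pose N := maxn N0 (\max_(k <- L m) k).+1.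
have LN k : k \in L m -> (k < N)%N.
  by move=> kL; rewrite /N leq_max orbC ltnS (@leq_bigmax_seq _ _ xpredT id).
(* If an omitted n < N had a nonzero coefficient, all coefficients in [L m] would be nonzero. As
   [L m] has more than N0 elements, one is at least N0, hence some element of [L m] exceeds n;
   strict decrease there contradicts greediness. *)
have c0 n : (n < N)%N -> n \notin L m -> c n = 0.
  move=> nN nL; apply/eqP; rewrite -normc_eq0E; apply/negPn/negP => cn.
  have cn0 : c n != 0 by rewrite -normc_eq0E.
  have cL k : k \in L m -> c k != 0.
    move=> kL; apply/negP => /eqP ck; move: (gr k n kL nL).
    rewrite -/c ck Normc.normc0; apply/negP.
    by rewrite -ltNge lt_neqAle eq_sym cn normc_ge0.
  have [k kL kN0] : exists2 k, k \in L m & (N0 <= k)%N.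
    apply: contrapT => nex; have sub : {subset L m <= iota 0 N0}.
      move=> k kL; rewrite mem_iota/= add0n ltnNge; apply/negP => ?.
      by apply: nex; exists k.
    have := uniq_leq_size (fset_uniq (L m)) sub; rewrite size_iota.
    by rewrite (_ : size (L m) = m)// leqNgt N0m.
  have [M ML nM] : exists2 M, M \in L m & (n < M)%N.
    have [nk|kn] := ltnP n k; first by exists k.
    have n0 : n != k by apply: contraNneq nL => ->.
    have knlt : (k < n)%N by rewrite ltn_neqAle eq_sym n0.
    move: nN; rewrite /N leq_max => /orP[|].
      by rewrite ltnNge (leq_trans kN0)// ltnW.
    rewrite ltnS => nmax; apply: contrapT => nex.
    have : (\max_(k <- L m) k <= n.-1)%N.
      apply/bigmax_leqP_seq => j jL _; rewrite -ltnS prednK; last exact: leq_trans knlt.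
      rewrite ltnNge; apply/negP => nj; apply: nex; exists j => //.
      by rewrite ltn_neqAle nj andbT; apply: contraNneq nL => ->.
    move=> /(leq_trans nmax); rewrite -ltnS prednK ?ltnn//.
    exact: leq_trans knlt.
  have := dec n M nM cn0 (cL M ML).
  by rewrite ltNge (gr M n ML nL).
rewrite (@eq_L1norm _ _ (fun x => walsh_partial_sum a g N x - g x)).
  by apply/ltW/hN0; rewrite leq_maxl.
move=> x _; congr (nc (_ - _)); rewrite /greedy_approximant /walsh_partial_sum -/c.
rewrite [RHS](bigID (fun k => k \in L m))/= [X in _ = _ + X]big1_seq ?addr0; last first.
  by move=> n /andP[nL]; rewrite mem_index_iota/= => nN; rewrite c0// mul0r.
rewrite -[RHS]big_filter; apply: perm_big; apply: uniq_perm.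
- exact: fset_uniq.
- by rewrite filter_uniq// iota_uniq.
- move=> k; rewrite mem_filter mem_index_iota/=.
  by case: (boolP (k \in L m)) => // /LN ->.
Qed.
End Greedy.

Section Completeness.
Context {R : realType}.
Local Notation mu := (@lebesgue_measure R).
Local Notation D := (`[0%R, 1%R[%classic : set R).
Local Notation nc := (@Normc.normc R).

(** Completeness of L^1: G, the sum of the |d_k|, is integrable, hence finite almost everywhere; the
    series converges absolutely where G is finite, and G dominates its partial sums. *)
Lemma l1_series_real (d : nat -> R -> R) :
  (forall k, measurable_fun D (d k)) ->
  (\sum_(0 <= k <oo) \int[mu]_(x in D) (`|d k x|)%:E < +oo)%E ->
  exists h : R -> R, mu.-integrable D (EFin \o h) /\
   (\int[mu]_(x in D) (`|\sum_(0 <= k < n) d k x - h x|)%:E @[n --> \oo] --> 0)%E.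
Proof.
move=> md fin.
pose G x : \bar R := (\sum_(0 <= k <oo) (`|d k x|)%:E)%E.
have mdE k : measurable_fun D (fun x => (`|d k x|)%:E).
  by apply/measurable_EFinP/measurableT_comp.
have mG : measurable_fun D G by apply: ge0_emeasurable_sum.
have G0 x : (0 <= G x)%E by apply: nneseries_ge0.
have iG : mu.-integrable D G.
  apply/integrableP; split => //.
  under eq_integral do rewrite gee0_abs//.
  by rewrite /G integral_nneseries//; exact: measurable_itv.
have partG n x : ((\sum_(0 <= k < n) `|d k x|)%:E <= G x)%E.
  by rewrite -sumEFin; apply: nneseries_lim_ge.
have cvgd x : (G x < +oo)%E -> cvgn (series (fun k => d k x)).
  move=> Gx; apply: normed_cvg; apply: nondecreasing_is_cvgn.
    move=> m n mn; rewrite /series/= [leRHS](big_cat_nat (leq0n _) mn)/= lerDl.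
    exact: sumr_ge0.
  exists (fine (G x)) => _ [n _ <-]; rewrite -lee_fin fineK ?ge0_fin_numE//.
  exact: partG.
pose A := D `&` [set x | (G x < +oo)%E].
have mA : measurable A by exact: emeasurable_fun_infty_o.
(* Zeroing the terms where G is infinite makes the series converge everywhere, so that its sum is
   measurable as a pointwise limit. *)
pose d' k x := if x \in A then d k x else 0.
have cvgd' x : cvgn (series (fun k => d' k x)).
  rewrite /d'; case: (boolP (x \in A)); first by rewrite inE => -[_ /cvgd].
  move=> _; rewrite (_ : series _ = (fun=> 0)); first exact: is_cvg_cst.
  by apply/funext => n; rewrite /series/= big1.
pose h x := limn (series (fun k => d' k x)).
have mh : measurable_fun D h.
  apply: (measurable_fun_cvg (h := fun n x => \sum_(0 <= k < n) d' k x)).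
    move=> n; apply: measurable_sum => k; apply: measurable_fun_if => //.
    - apply: (measurable_fun_bool true).
      rewrite (_ : _ `&` _ = A)//; apply/seteqP; split=> [x [_ /= /set_mem//]|x Ax].
      by split; [case: Ax|exact: mem_set].
    - by apply: measurable_funS (md k) => // x [].
  by move=> x _; exact: cvgd'.
have [|||||+ +  _] := @dominated_convergence _ _ R mu D _
   (fun n x => (\sum_(0 <= k < n) d k x)%:E) (EFin \o h) G _ _ _ iG.
- exact: measurable_itv.
- by move=> n; apply/measurable_EFinP; exact: measurable_sum.
- exact/measurable_EFinP.
- have := @integrable_ae _ _ _ mu D (measurable_itv _) G iG; apply: filterS => x Gx Dx.
  have {Gx}Gx : (G x < +oo)%E by rewrite -ge0_fin_numE//; exact: Gx.
  apply: cvg_EFin; first by near=> n.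
  have -> : (fine \o (fun n => (\sum_(0 <= k < n) d k x)%:E)) = series (fun k => d' k x).
    by apply/funext => n /=; apply: eq_bigr => k _; rewrite /d' mem_set.
  exact: cvgd'.
- apply: aeW => x n _; apply: le_trans (partG n x).
  by rewrite lee_fin ler_norm_sum.
by move=> ih cv; exists h; split.
Unshelve. all: by end_near. Qed.

Lemma l1_series (d : nat -> R -> R[i]) :
  (forall k, inL1 (d k)) -> (\sum_(0 <= k <oo) L1norm (d k) < +oo)%E ->
  exists h, inL1 h /\ cvgL1 (fun n x => \sum_(0 <= k < n) d k x) h.
Proof.
move=> id fin.
have md k : cmeas (d k) by have /inL1P[] := id k.
have mR k : measurable_fun D (@complex.Re R \o d k) by case: (md k).
have mI k : measurable_fun D (@complex.Im R \o d k) by case: (md k).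
have [|h1 [ih1 ch1]] := l1_series_real mR.
  apply: le_lt_trans fin; apply: lee_nneseries => [k _ _|k _].
    by apply: integral_ge0 => x _; rewrite lee_fin.
  apply: ge0_le_integral => //; [|exact: cmeas_norm_EFin|].
    by apply/measurable_EFinP/measurableT_comp => //; exact: mR.
  by move=> x _; rewrite lee_fin Re_le_normc.
have [|h2 [ih2 ch2]] := l1_series_real mI.
  apply: le_lt_trans fin; apply: lee_nneseries => [k _ _|k _].
    by apply: integral_ge0 => x _; rewrite lee_fin.
  apply: ge0_le_integral => //; [|exact: cmeas_norm_EFin|].
    by apply/measurable_EFinP/measurableT_comp => //; exact: mI.
  by move=> x _; rewrite lee_fin Im_le_normc.
exists (fun x => Complex (h1 x) (h2 x)); split; first by split.
apply: ecvg0_le => [n|e e0]; first exact: L1norm_ge0.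
have e2 : 0 < e / 2 by rewrite divr_gt0.
have [N1 hN1] := ecvg0_lt ch1 e2; have [N2 hN2] := ecvg0_lt ch2 e2.
exists (maxn N1 N2) => n; rewrite geq_max => /andP[/hN1/ltW le1 /hN2/ltW le2].
have -> : e%:E = ((e / 2)%:E + (e / 2)%:E)%E.
  by rewrite -EFinD -mulr2n -(mulr_natr (e / 2)) divfK.
apply: le_trans (leeD le1 le2).
have m1 : measurable_fun D h1 by apply/measurable_EFinP; exact: measurable_int ih1.
have m2 : measurable_fun D h2 by apply/measurable_EFinP; exact: measurable_int ih2.
have M1 : measurable_fun D (fun x => (`|\sum_(0 <= k < n) complex.Re (d k x) - h1 x|)%:E).
  apply/measurable_EFinP/measurableT_comp => //; apply: measurable_funB => //.
  exact: measurable_sum.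
have M2 : measurable_fun D (fun x => (`|\sum_(0 <= k < n) complex.Im (d k x) - h2 x|)%:E).
  apply/measurable_EFinP/measurableT_comp => //; apply: measurable_funB => //.
  exact: measurable_sum.
rewrite -ge0_integralD//.
apply: ge0_le_integral => //.
- by move=> x _; rewrite lee_fin normc_ge0.
- apply: cmeas_norm_EFin; apply: cmeasB; last by split.
  exact: cmeas_sum.
- exact: emeasurable_funD.
- move=> x _; rewrite -EFinD lee_fin (le_trans (normc_le_ReIm _))//.
  rewrite le_eqVlt; apply/orP; left; apply/eqP.
  have -> : \sum_(0 <= k < n) d k x = Complex (\sum_(0 <= k < n) complex.Re (d k x))
     (\sum_(0 <= k < n) complex.Im (d k x)).
    elim/big_ind3 : _ => //; last by move=> i _; case: (d i x).
    by move=> ? ? ? ? ? ? -> ->.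
  by [].
Qed.

End Completeness.

(** * The iteration *)

Section Iteration.
Context {R : realType} (a : nat) (a1 : (1 < a)%N).
Local Notation mu := (@lebesgue_measure R).
Local Notation D := (`[0%R, 1%R[%classic : set R).
Local Notation nc := (@Normc.normc R).
Local Notation wsum := (walsh_sum a).

(** The polynomial built so far with its length, the part of the function still to be approximated,
    and the exceptional set of the latest step alone. *)
Record state := State {
  st_len : nat; st_coef : nat -> R[i]; st_rest : R -> R[i]; st_exc : set R }.

Definition state_ok (s : state) :=
  [/\ forall n, st_coef s n != 0 -> (n < st_len s)%N,
      nonzero_decreasing (st_coef s) & inL1 (st_rest s)].

Definition st_sum (s : state) : R -> R[i] := wsum (st_coef s) (st_len s).

(** The last clause controls all intermediate partial sums; without it only the subsequence of
    completed stages would be seen to converge. *)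
Definition step (del eta : R) (s s' : state) :=
  [/\ (st_len s < st_len s')%N /\
        (forall n, (n < st_len s)%N -> st_coef s' n = st_coef s n),
      state_ok s',
      [/\ measurable (st_exc s'), (mu (st_exc s') <= del%:E)%E &
        forall x, st_rest s' x =
          if x \in st_exc s' then 0 else st_rest s x - (st_sum s' x - st_sum s x)],
      (L1norm (st_rest s') <= eta%:E)%E &
      forall M, (st_len s <= M)%N ->
        (L1norm (fun x => wsum (st_coef s') M x - st_sum s x)%R <=
         2%:E * L1norm (st_rest s) + eta%:E)%E].

(** New coefficients kept below this bound preserve the strict decrease across stages. *)
Lemma nonzero_lower_bound (c : nat -> R[i]) N :
  exists2 kap : R, 0 < kap & forall n, (n < N)%N -> c n != 0 -> kap <= nc (c n).
Proof.
elim: N => [|N [kap k0 hk]]; first by exists 1.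
have [cN|cN] := eqVneq (c N) 0.
  exists kap => // n; rewrite ltnS leq_eqVlt => /orP[/eqP ->|]; last exact: hk.
  by rewrite cN eqxx.
exists (Num.min kap (nc (c N))).
  by rewrite lt_min k0 lt_neqAle eq_sym normc_eq0E cN normc_ge0.
move=> n; rewrite ltnS leq_eqVlt => /orP[/eqP -> _|nN cn]; rewrite ge_min ?lexx ?orbT//.
by rewrite hk.
Qed.

Lemma step_exists (del eta : R) (s : state) : 0 < del -> 0 < eta -> state_ok s ->
  exists s', step del eta s s'.
Proof.
move=> del0 eta0 [supp dec lr].
have [kap k0 hk] := nonzero_lower_bound (st_coef s) (st_len s).
have [c [N [E [[lN csupp] ck cdec [mE muE offE] cL1]]]] :=
  approx_off_small_set a1 (st_len s) lr k0 del0 eta0.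
pose C n := st_coef s n + c n.
have c0 n : (n < st_len s)%N -> c n = 0.
  by move=> h; apply/eqP/negP => /negP/csupp; rewrite leqNgt h.
have s0 n : (st_len s <= n)%N -> st_coef s n = 0.
  by move=> h; apply/eqP/negP => /negP/supp; rewrite ltnNge h.
have CM M : (st_len s <= M)%N -> (fun x => wsum C M x - st_sum s x) = wsum c M.
  move=> h; apply/funext => x.
  by rewrite wsumD (wsum_widen _ x supp h) /st_sum addrAC subrr add0r.
have sub : (fun x => wsum C N x - st_sum s x) = wsum c N by apply: CM; exact: ltnW.
pose r x := if x \in E then 0 else st_rest s x - (wsum C N x - st_sum s x).
have rE : r = fun x => if x \in E then 0 else st_rest s x - wsum c N x.
  by apply/funext => x; rewrite /r -sub.
have cases n : C n != 0 ->
    [/\ (n < st_len s)%N, st_coef s n != 0 & C n = st_coef s n] \/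
    [/\ (st_len s <= n)%N, c n != 0 & C n = c n].
  rewrite /C; have [h|h] := ltnP n (st_len s); first by rewrite (c0 n h) addr0; left.
  by rewrite (s0 n h) add0r; right.
exists (State N C r E); split => /=.
- by split=> // n h; rewrite /C c0 ?addr0.
- split => /=.
  + move=> n /cases[[h _ _]|[_ /csupp/andP[_ h] _]]//; exact: ltn_trans lN.
  + move=> m n mn /cases[[m1 m2 ->]|[m1 m2 ->]] /cases[[n1 n2 ->]|[n1 n2 ->]].
    * exact: dec.
    * by rewrite (lt_le_trans (ck n))// hk.
    * by have := ltn_trans mn n1; rewrite ltnNge m1.
    * exact: cdec.
  + rewrite rE; apply/inL1P; split; last by rewrite (le_lt_trans offE)// ltry.
    have /inL1P[mr _] := lr; have mc := wsum_meas a1 c N.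
    by apply: cmeas_if => //; [exact: cmeas_cst|exact: cmeasB].
- by [].
- by rewrite rE.
- by move=> M /CM ->.
Qed.

Lemma iteration (f : R -> R[i]) (del eta : nat -> R) : inL1 f ->
  (forall n, 0 < del n) -> (forall n, 0 < eta n) ->
  exists s : nat -> state,
    [/\ s 0%N = State 0 (fun=> 0) f set0, forall n, state_ok (s n) &
        forall n, step (del n) (eta n) (s n) (s n.+1)].
Proof.
move=> lf del0 eta0.
(* [choice] wants a successor for every pair, so a state violating the invariant is sent to itself;
   the induction below shows that none is reached. *)
have /choice[F hF] : forall ns : nat * state, exists s',
    state_ok ns.2 -> step (del ns.1) (eta ns.1) ns.2 s'.
  move=> [n s]; have [ok|nok] := pselect (state_ok s); last by exists s.
  by have [s' h] := step_exists (del0 n) (eta0 n) ok; exists s'.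
pose s := fix s n := if n is n'.+1 then F (n', s n') else State 0 (fun=> 0) f set0.
have ok n : state_ok (s n).
  elim: n => [|n IH]; last by have [] := hF (n, s n) IH.
  by split => //= [n|m n _]; rewrite eqxx.
exists s; split => // n; exact: (hF (n, s n) (ok n)).
Qed.

End Iteration.

(** * Uniqueness of Walsh coefficients and assembly of the theorem *)

Section Final.
Context {R : realType}.
Local Notation mu := (@lebesgue_measure R).
Local Notation D := (`[0%R, 1%R[%classic : set R).
Local Notation nc := (@Normc.normc R).

Lemma measurable_neq (f g : R -> R[i]) : cmeas f -> cmeas g ->
  measurable [set x : R | (0 <= x < 1)%R /\ g x <> f x].
Proof.
move=> mf mg; have md := cmeas_normc (cmeasB mg mf).
rewrite (_ : mkset _ = D `&` (nc \o (fun x => g x - f x)) @^-1` (~` [set 0])).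
  by apply: md => //; apply: measurableC; exact: measurable_set1.
apply/seteqP; split => x [Dx ne]; split; rewrite ?memD// -?memD// => e; apply: ne.
  by apply/eqP; rewrite -subr_eq0 -normc_eq0E; apply/eqP.
by rewrite /= e subrr Normc.normc0.
Qed.

(** The n-th coefficient is continuous for the L^1 norm, and it equals c_n on every partial sum of
    order above n. *)
Lemma walsh_coef_of_cvgL1 (a : nat) (a1 : (1 < a)%N) (c : nat -> R[i]) (g : R -> R[i]) :
  inL1 g -> cvgL1 (walsh_sum a c) g -> walsh_coef a g = c.
Proof.
move=> lg cv; apply/funext => n; apply/eqP; rewrite -subr_eq0 -normc_eq0E eq_le normc_ge0 andbT.
apply/ler_addgt0Pr => e e0; rewrite add0r.
have e2 : 0 < e / 2 by rewrite divr_gt0.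
have [M hM] := ecvg0_lt cv e2.
pose m := maxn M n.+1; have {hM} := hM m (leq_maxl _ _).
have W (u : R -> R[i]) : inL1 u -> inL1 (fun x => u x * (walsh a n x)^*%C) /\
    (L1norm (fun x => u x * (walsh a n x)^*%C)%R <= 1%:E * L1norm u)%E.
  move=> lu; apply: inL1_Mbounded => //; first exact/cmeasJ/walsh_meas.
  by move=> x Dx; rewrite normcJ_eq (walsh_norm_le a1).
have lw := wsum_inL1 a1 c m.
move=> hm; rewrite -lee_fin.
have -> : walsh_coef a g n - c n = cintegral (fun x => (-1) * ((walsh_sum a c m x - g x) * (walsh a n x)^*%C)).
  have {1}-> : c n = cintegral (fun x => walsh_sum a c m x * (walsh a n x)^*%C).
    by rewrite walsh_sum_coef// leq_maxr.
  rewrite /walsh_coef -[- cintegral _]mulN1r -cintegralZ; last by case: (W _ lw).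
  rewrite -cintegralD; last 2 first.
  - by case: (W _ lg).
  - by apply: inL1Z; case: (W _ lw).
  by apply: eq_cintegral => x _; ring.
have [l1 l2] := W _ (inL1B lw lg).
apply: (le_trans (normc_cintegral_le (inL1Z (-1) l1))).
have ml1 : cmeas (fun x => (walsh_sum a c m x - g x) * (walsh a n x)^*%C) by have /inL1P[] := l1.
rewrite L1normZ// normcN Normc.normc1 mul1e.
have -> : e%:E = (2%:E * (e / 2)%:E)%E by rewrite -EFinM mulrC divfK.
apply: lee_wpmul2l => //; apply: (le_trans l2); rewrite mul1e; exact: ltW.
Qed.

End Final.

Theorem theorem1p5 (R : realType) (a : nat) (ha : (2 <= a)%N)
  (eps : R) (heps0 : 0 < eps) (heps1 : eps < 1)
  (f : R -> R[i]) (hf : inL1 f) :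
  exists g : R -> R[i],
    [/\ inL1 g,
        (lebesgue_measure [set x : R | (0 <= x < 1)%R /\ g x <> f x]
           < eps%:E)%E,
        cvgL1 (walsh_partial_sum a g) g,
        nonzero_decreasing (walsh_coef a g)
      & greedy_algorithm_cvg a g].
Proof.
(* The weights 1 / 2^(n+1) sum to 1, so the exceptional sets have total measure at most eps/2, which
   leaves room for the strict inequality. *)
pose pw n := (2 ^ n.+1)%:R : R.
have pw0 n : 0 < pw n by rewrite ltr0n expn_gt0.
pose del n := eps / 2 / pw n; pose eta n := 1 / pw n.
have del0 n : 0 < del n by rewrite !divr_gt0.
have eta0 n : 0 < eta n by rewrite divr_gt0.
have [s [s0 sok sstep]] := iteration ha hf del0 eta0.
pose Nn n := st_len (s n); pose C n := st_coef (s n).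
pose Q n := st_sum a (s n); pose r n := st_rest (s n).
have Nlt n : (Nn n < Nn n.+1)%N by case: (sstep n) => -[].
have Nmono m n : (m <= n)%N -> (Nn m <= Nn n)%N.
  elim: n => [|n IH]; first by rewrite leqn0 => /eqP ->.
  rewrite leq_eqVlt => /orP[/eqP ->//|/IH le].
  exact: leq_trans le (ltnW (Nlt n)).
have Nge n : (n <= Nn n)%N by elim: n => // n IH; exact: leq_trans (Nlt n).
have Cst k j n : (k <= j)%N -> (n < Nn k)%N -> C j n = C k n.
  move=> kj nk; elim: j kj => [|j IH]; first by rewrite leqn0 => /eqP ->.
  rewrite leq_eqVlt => /orP[/eqP ->//|]; rewrite ltnS => kj.
  rewrite -IH//; case: (sstep j) => -[_ h] _ _ _ _; apply: h.
  exact: leq_trans nk (Nmono _ _ kj).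
(* Stage n+1 has length at least n+1, so the coefficient of index n is final by then. *)
pose c n := C n.+1 n.
have cE k n : (n < Nn k)%N -> c n = C k n.
  move=> nk; rewrite /c; have [h|/ltnW h] := leqP n.+1 k.
    by rewrite (Cst _ _ _ h)// Nge.
  exact: Cst.
have [L LE] : exists L : R, L1norm f = L%:E.
  exists (fine (L1norm f)); rewrite fineK// ge0_fin_numE ?L1norm_ge0//.
  by have /inL1P[] := hf.
have L0 : 0 <= L by rewrite -lee_fin -LE L1norm_ge0.
(* One formula for two cases: the initial remainder has norm L, and that of stage n+1 is at most
   eta_n = 2 / 2^(n+2). *)
have rL n : (L1norm (r n) <= ((L + 1) * 2 / pw n)%R%:E)%E.
  case: n => [|n].
    rewrite /r s0 LE lee_fin /pw expn1 mulfK ?pnatr_eq0//.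
    by rewrite lerDl.
  case: (sstep n) => _ _ _ h _; apply: (le_trans h); rewrite lee_fin /eta /pw.
  rewrite [(2 ^ n.+2)%N]expnS natrM invfM mulrA mulfK ?pnatr_eq0//.
  by rewrite ler_wpM2r ?invr_ge0// ler_wpDl.
(* Twice the bound on the remainder of stage n plus eta_n is exactly K / 2^(n+1). *)
pose K : R := (L + 1) * 4 + 1.
have K0 : 0 < K by rewrite /K; lra.
have near_Q n M : (Nn n <= M)%N -> (M <= Nn n.+1)%N ->
    (L1norm (fun x => walsh_sum a c M x - Q n x)%R <= (K / pw n)%:E)%E.
  move=> h1 h2; case: (sstep n) => _ _ _ _ /(_ M h1) h.
  rewrite (@eq_L1norm _ _ (fun x => walsh_sum a (C n.+1) M x - Q n x)); last first.
    move=> x _; congr (Normc.normc (_ - _)); apply: eq_big_nat => k /andP[_ kM].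
    by rewrite (cE n.+1)// (leq_trans kM).
  apply: (le_trans h).
  apply: (@le_trans _ _ (2%:E * ((L + 1) * 2 / pw n)%R%:E + (eta n)%:E)%E).
    apply: leeD => //; apply: lee_wpmul2l => //; exact: rL.
  rewrite -EFinM -EFinD lee_fin /K /eta le_eqVlt; apply/orP; left; apply/eqP.
  by field; rewrite gt_eqF.
have QE n : Q n = walsh_sum a c (Nn n).
  by apply/funext => x; apply: eq_big_nat => k /andP[_ kM]; rewrite (cE n).
have lQ n : inL1 (Q n) by exact: wsum_inL1.
have mQ n : cmeas (Q n) by have /inL1P[] := lQ n.
have [h [lh ch]] : exists h, inL1 h /\ cvgL1 Q h.
  pose d n x := Q n.+1 x - Q n x.
  have [||h [lh ch]] := @l1_series R d.
  - by move=> n; exact: inL1B.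
  - apply: (@le_lt_trans _ _ K%:E); last exact: ltry.
    apply: le_trans (epsilon_trick0 xpredT (ltW K0)).
    apply: lee_nneseries => n *; first exact: L1norm_ge0.
    by rewrite /d QE; apply: near_Q => //; exact: ltnW.
  exists h; split => //; move: ch; congr (cvgL1 _ h).
  apply/funext => n; apply/funext => x; rewrite telescope_sumr//.
  by rewrite [Q 0%N]QE /Nn s0 /= /walsh_sum big_geq// subr0.
pose E : set R := \bigcup_n st_exc (s n.+1).
have mEn n : measurable (st_exc (s n.+1)) by case: (sstep n) => _ _ [].
have mE : measurable E by apply: bigcupT_measurable.
have muE : (lebesgue_measure E <= (eps / 2)%:E)%E.
  apply: (le_trans (measure_sigma_subadditive lebesgue_measure mEn mE (@subset_refl _ E))).
  have e2 : 0 <= eps / 2 by rewrite ltW// divr_gt0.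
  apply: le_trans (epsilon_trick0 xpredT e2); apply: lee_nneseries => // n _.
  by case: (sstep n) => _ _ [].
have rE n x : ~ E x -> r n x = f x - Q n x.
  move=> nE; elim: n => [|n IH].
    by rewrite [Q 0%N]QE /r /Nn s0 /= /walsh_sum big_geq// subr0.
  case: (sstep n) => _ _ [_ _ re] _ _; rewrite /r re memNset; last by move=> ?; apply: nE; exists n.
  by rewrite -/(r n) IH /Q; ring.
(* The L^1 limit h is determined only almost everywhere; using f itself off E makes g and f agree
   there at every point. *)
pose g x := if x \in E then h x else f x.
have [mf _] := (inL1P f).1 hf; have [mh _] := (inL1P h).1 lh.
have mg : cmeas g by exact: cmeas_if.
have lg : inL1 g.
  pose chi x : R[i] := if x \in E then 1 else 0.
  have [lc _] : inL1 (fun x => (h x - f x) * chi x) /\ (L1norm (fun x => (h x - f x) * chi x)%R <=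
     1%:E * L1norm (fun x => h x - f x)%R)%E.
    apply: inL1_Mbounded; first exact: inL1B.
      by apply: cmeas_if => //; exact: cmeas_cst.
    by move=> x _; rewrite /chi; case: ifP; rewrite ?Normc.normc1 ?Normc.normc0.
  apply: inL1_eq (inL1D hf lc) => x _; rewrite /g /chi.
  by case: ifP => _; ring.
(* On E the error is that of Q against h; off E it is the remainder, which tends to 0 in norm. *)
have Qg : cvgL1 Q g.
  apply: ecvg0_le => [n|e e0]; first exact: L1norm_ge0.
  have e2 : 0 < e / 2 by rewrite divr_gt0.
  have [N1 hN1] := ecvg0_lt ch e2.
  have [N2 hN2] := div_exp_small (isT : (1 < 2)%N) ((L + 1) * 2) e2.
  exists (maxn N1 N2) => n; rewrite geq_max => /andP[/hN1/ltW le1 N2n].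
  have le2 : (L1norm (r n) <= (e / 2)%:E)%E.
    by apply: (le_trans (rL n)); rewrite lee_fin ltW// hN2// ltnW.
  have -> : e%:E = ((e / 2)%:E + (e / 2)%:E)%E.
    by rewrite -EFinD -mulr2n -(mulr_natr (e / 2)) divfK.
  apply: le_trans (leeD le2 le1); apply: L1norm_le_add.
  - exact: cmeasB.
  - by case: (sok n) => _ _ /inL1P[].
  - exact: cmeasB.
  - move=> x _; rewrite /g; case: (boolP (x \in E)) => [_|]; first by rewrite lerDr normc_ge0.
    rewrite notin_setE => nE; rewrite rE//.
    by rewrite -normcN opprB lerDl normc_ge0.
have cvg_c : cvgL1 (walsh_sum a c) g.
  apply: ecvg0_le => [n|e e0]; first exact: L1norm_ge0.
  have e2 : 0 < e / 2 by rewrite divr_gt0.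
  have [N1 hN1] := ecvg0_lt Qg e2.
  have [N2 hN2] := div_exp_small (isT : (1 < 2)%N) K e2.
  pose k0 := maxn N1 N2.
  (* Every large M lies between two consecutive stage lengths, where [near_Q] compares the partial
     sum with the completed stage. *)
  have loc M : (Nn k0 <= M)%N -> exists k, [/\ (k0 <= k)%N, (Nn k <= M)%N & (M <= Nn k.+1)%N].
    elim: M => [|M IH].
      by move=> h0; exists k0; split.
    rewrite leq_eqVlt => /orP[/eqP <-|/IH[k [h1 h2 h3]]].
      by exists k0; split => //; exact: ltnW.
    move: h3; rewrite leq_eqVlt => /orP[/eqP e3|h3].
      exists k.+1; split; rewrite ?e3//; exact: leqW.
    by exists k; split => //; exact: leqW.
  exists (Nn k0) => M /loc[k [k0k kM Mk]].
  move: k0k; rewrite geq_max => /andP[/hN1/ltW le1 N2k].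
  have le2 : (L1norm (fun x => walsh_sum a c M x - Q k x)%R <= (e / 2)%:E)%E.
    by apply: (le_trans (near_Q k M kM Mk)); rewrite lee_fin ltW// hN2// ltnW.
  have -> : e%:E = ((e / 2)%:E + (e / 2)%:E)%E.
    by rewrite -EFinD -mulr2n -(mulr_natr (e / 2)) divfK.
  have mw : cmeas (walsh_sum a c M) by exact: wsum_meas.
  apply: le_trans (leeD le2 le1); apply: L1norm_le_add; try exact: cmeasB.
  by move=> x _; apply: le_trans (le_normcD _ _); rewrite subrKA.
have coefE := walsh_coef_of_cvgL1 ha lg cvg_c.
have psE : walsh_partial_sum a g = walsh_sum a c.
  by apply/funext => n; apply/funext => x; rewrite /walsh_partial_sum coefE.
have dec : nonzero_decreasing (walsh_coef a g).
  rewrite coefE => m n mn; have nN : (n < Nn n.+1)%N := Nge n.+1.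
  rewrite (cE _ _ nN) (cE _ _ (ltn_trans mn nN)).
  by case: (sok n.+1) => _ dn _; exact: dn.
have cv : cvgL1 (walsh_partial_sum a g) g by rewrite psE.
exists g; split => //; last exact: greedy_cvg_decreasing.
apply: (@le_lt_trans _ _ (lebesgue_measure E)).
  apply: le_measure; rewrite ?inE//; first exact: measurable_neq.
  move=> x [_]; rewrite /g; case: (boolP (x \in E)) => //.
  by move=> /set_mem.
by apply: (le_lt_trans muE); rewrite lte_fin ltr_pdivrMr// ltr_pMr// ltr1n.
Qed.
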